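(* Let $\omega:\mathbb{C}\to[0,\infty)$ be a proper height function, with open sublevel sets $D_r=\{z\in\mathbb{C}:\omega(z)<r\}$ for $r>0$. Let $(f_n)_{n\geq1}$ be a sequence of entire functions that has convergence level $0<\rho<\infty$ for $\omega$, such that the limit of $(f_n)$ in $D_\rho$ is non-constant. Suppose $(f_n)$ allows an admissible sequence of growth exponents $\lambda_1<\lambda_2<\cdots<\lambda_n\to\infty$ whose growth function $$\mu(z)=\limsup_{n\to\infty}|f_n(z)|^{1/\lambda_n}\qquad(z\in\mathbb{C})$$ satisfies, for some $r>0$, $$\{z:\omega(z)>\rho\}\subset\{z:\mu(z)>1\}\cup\{z:\omega(z)=r\}.$$ Then every point of $\partial D_\rho$ is a cluster point of zeros of the $f_n$, and $D_\rho$ is the maximal open set in which $(f_n)$ converges pointwise (that is, $(f_n)$ converges pointwise on $D_\rho$ and every open set on which $(f_n)$ converges pointwise is contained in $D_\rho$).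
   Context: Proper height function: a continuous function $\omega:\mathbb{C}\to[0,\infty)$ such that the open sublevel sets $D_r:=\{\omega<r\}$ are nonempty for all $r>0$ and there are no local maxima of positive height, that is, equivalently, $\overline{\{\omega>r\}}=\{\omega\geq r\}$ for all $r>0$ (overline denotes closure in $\mathbb{C}$). Convergence level of $(f_n)$ for $\omega$: $\rho:=\sup\{r>0: f_n\text{ converges compactly on }D_r\}$, where $\rho=0$ if there is no such $D_r$ and $\rho=\infty$ if there is convergence in all of the $D_r$. ''Converges compactly'' means converges uniformly on compact subsets. If $0<\rho<\infty$, then $(f_n)$ converges compactly on $D_\rho$ itself, since $\overline{D_r}\subset D_{r'}$ for $0<r<r'$ and $D_\rho=\bigcup_{r<\rho}D_r$. $\partial D_\rho$ is the boundary of $D_\rho$ in $\mathbb{C}$. Admissible growth exponents: a strictly increasing real sequence $\lambda_1<\lambda_2<\cdots<\lambda_n\to\infty$ is an admissible sequence of growth exponents for the sequence $(f_n)$ of entire functions if for every compact $K\subset\mathbb{C}$ there is a constant $c(K)<\infty$ with $$\limsup_{n\to\infty}\max_{z\in K}|f_n(z)|^{1/\lambda_n}\leq c(K).$$ (Only large $n$, for which $\lambda_n>0$, matter.) In this case the growth function $\mu$ is well defined. A point $z_0$ is a cluster point of zeros of the $f_n$ if for every open neighborhood $U$ of $z_0$ and every $n_0$ there is some $n\geq n_0$ such that $f_n$ has a zero in $U$.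
   Formalization: The limit of (f_n) is assumed non-constant on every connected component of D_ρ, not merely on D_ρ as a whole; when D_ρ is disconnected and the limit vanishes on one component, the claim about zeros can fail. *)

(* Defs.v *)
(* Stdlib world: the concrete reals [R] and Coquelicot's complex numbers [C]. *)
From Stdlib Require Import Reals Lra List Classical.
From Coquelicot Require Import Coquelicot.
Open Scope R_scope.

(** * Topology of the plane *)

Definition Copen (U : C -> Prop) : Prop := open (T := C_UniformSpace) U.

Definition Cclosure (A : C -> Prop) (z : C) : Prop :=
  forall U : C -> Prop, Copen U -> U z -> exists w, U w /\ A w.

Definition Cboundary (A : C -> Prop) (z : C) : Prop :=
  Cclosure A z /\ Cclosure (fun w => ~ A w) z.

Definition Ccompact (K : C -> Prop) : Prop :=
  forall (I : Type) (U : I -> C -> Prop),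
    (forall i, Copen (U i)) ->
    (forall z, K z -> exists i, U i z) ->
    exists l : list I, forall z, K z -> exists i, In i l /\ U i z.

(* The empty set is allowed. *)
Definition Cconnected (A : C -> Prop) : Prop :=
  forall U V : C -> Prop, Copen U -> Copen V ->
    (forall z, A z -> U z \/ V z) ->
    (exists z, A z /\ U z) -> (exists z, A z /\ V z) ->
    exists z, A z /\ U z /\ V z.

Definition component (D : C -> Prop) (z w : C) : Prop :=
  exists A : C -> Prop,
    Cconnected A /\ (forall x, A x -> D x) /\ A z /\ A w.

(** * Entire functions and modes of convergence *)

Definition entire (f : C -> C) : Prop :=
  forall z : C, ex_derive (K := C_AbsRing) (V := C_NormedModule) f z.

Definition tends_to (u : nat -> C) (l : C) : Prop :=
  filterlim u eventually (locally (T := C_UniformSpace) l).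

Definition converges_pointwise_on (f : nat -> C -> C) (A : C -> Prop) : Prop :=
  forall z, A z -> exists l, tends_to (fun n => f n z) l.

Definition converges_uniformly_to_on
    (f : nat -> C -> C) (g : C -> C) (K : C -> Prop) : Prop :=
  forall eps : posreal,
    eventually (fun n => forall z, K z -> Cmod (f n z - g z)%C < eps).

Definition converges_compactly_on (f : nat -> C -> C) (D : C -> Prop) : Prop :=
  exists g : C -> C, forall K : C -> Prop,
    Ccompact K -> (forall z, K z -> D z) -> converges_uniformly_to_on f g K.

Definition maximal_open_pointwise_convergence
    (f : nat -> C -> C) (D : C -> Prop) : Prop :=
  Copen D /\ converges_pointwise_on f D /\
  forall U : C -> Prop,
    Copen U -> converges_pointwise_on f U -> forall z, U z -> D z.

Definition cluster_point_of_zeros (f : nat -> C -> C) (z0 : C) : Prop :=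
  forall U : C -> Prop, Copen U -> U z0 ->
    forall n0 : nat, exists n, (n0 <= n)%nat /\ exists w, U w /\ f n w = RtoC 0.

(** A function on a (possibly disconnected) open set counts as non-constant
    when it is constant on no connected component of it.  If [D] is connected
    this is non-constancy on [D].  On a disconnected [D] mere non-constancy on
    the union would not be enough for the main result: take
    [omega z = exp (y^2 - x^2)] for [z = x + i y], [rho = 1], [lambda_n = n] and
    [f_n z = z * erfc (- sqrt n * z) / 2].  The limit is [z] on the right sector
    of [{x^2 > y^2}] and [0] on the left one, [mu = exp (y^2 - x^2) > 1] on
    [{omega > 1}], but the [f_n] with [n] large have no zeros near [-1 + i]. *)
Definition nonconstant_on_open (g : C -> C) (D : C -> Prop) : Prop :=
  forall z, D z ->
    exists a b, component D z a /\ component D z b /\ g a <> g b.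

(** * Height functions and the convergence level *)

Definition sublevel (omega : C -> R) (r : R) (z : C) : Prop := omega z < r.

Record proper_height (omega : C -> R) : Prop := {
  height_continuous : forall z : C,
    continuous (T := C_UniformSpace) (U := R_UniformSpace) omega z;
  height_nonneg : forall z, 0 <= omega z;
  height_sublevel_nonempty : forall r, 0 < r -> exists z, sublevel omega r z;
  height_closure : forall r, 0 < r ->
    forall z, Cclosure (fun w => r < omega w) z <-> r <= omega z
}.

Lemma height_closure_iff_no_local_max (omega : C -> R) :
  (forall z : C,
     continuous (T := C_UniformSpace) (U := R_UniformSpace) omega z) ->
  (forall r, 0 < r ->
     forall z, Cclosure (fun w => r < omega w) z <-> r <= omega z)
  <->
  ~ (exists z, 0 < omega z /\
       locally (T := C_UniformSpace) z (fun w => omega w <= omega z)).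
Proof.
intros Hc; split.
- intros H [z [Hz Hloc]].
  destruct (proj2 (H (omega z) Hz z) (Rle_refl _)
              (fun w => locally (T := C_UniformSpace) w
                          (fun x => omega x <= omega z))) as [w [Hw Hlt]].
  + intros x Hx; exact (locally_locally x _ Hx).
  + exact Hloc.
  + apply locally_singleton in Hw; lra.
- intros H r Hr z; split.
  + intros Hcl; apply Rnot_lt_le; intros Hlt.
    destruct (Hcl (fun w => omega w < r)) as [w [Hw1 Hw2]].
    * apply (open_comp (T := C_UniformSpace) (U := R_UniformSpace)
               omega (fun u => u < r)).
      -- intros x _; exact (Hc x).
      -- apply open_lt.
    * exact Hlt.
    * lra.
  + intros Hle U HU Uz.
    apply NNPP; intros Hno.
    apply H; exists z; split; [lra|].
    apply (filter_imp U); [|exact (HU z Uz)].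
    intros w Uw; apply Rnot_lt_le; intros Hlt.
    apply Hno; exists w; split; [exact Uw | lra].
Qed.

(** The point [0] is added so that the supremum is [0], not [-oo], when the
    sequence converges compactly on no sublevel set. *)
Definition convergence_level (omega : C -> R) (f : nat -> C -> C) : Rbar :=
  Lub_Rbar (fun r =>
    r = 0 \/ (0 < r /\ converges_compactly_on f (sublevel omega r))).

(** * Growth exponents *)

(** [x ^ y] for [x >= 0] and [y > 0].  Stdlib's [Rpower 0 y] is [1]. *)
Definition rpow (x y : R) : R := if Rlt_dec 0 x then Rpower x y else 0.

(** The supremum of [h] on [K]; it is the maximum when [K] is compact and
    nonempty and [h] is continuous, and [0] when [K] is empty. *)
Definition max_on (K : C -> Prop) (h : C -> R) : R :=
  real (Lub_Rbar (fun y => exists z, K z /\ y = h z)).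

Definition root_modulus
    (f : nat -> C -> C) (lambda : nat -> R) (n : nat) (z : C) : R :=
  rpow (Cmod (f n z)) (/ lambda n).

(** The finitely many [n] with [lambda n <= 0], for which [root_modulus] has no
    meaning, do not influence the upper limits below. *)
Definition admissible_exponents
    (f : nat -> C -> C) (lambda : nat -> R) : Prop :=
  (forall n, lambda n < lambda (S n)) /\
  is_lim_seq lambda p_infty /\
  forall K : C -> Prop, Ccompact K ->
    exists c : R,
      Rbar_le (LimSup_seq (fun n => max_on K (root_modulus f lambda n))) c.

Definition growth_function
    (f : nat -> C -> C) (lambda : nat -> R) (z : C) : Rbar :=
  LimSup_seq (fun n => root_modulus f lambda n z).

(* Main.v *)
(** A point with [omega > rho] and [omega <> r] lies in every neighbourhood of
    every point with [omega >= rho], because [omega] has no local maximum at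
    height [r]; there [mu > 1], so [f n] does not converge.  This gives the
    maximality of [D_rho].

    If a boundary point had a disc on which all [f n] with [n >= n0] are
    zero-free, then [G_n = log (f n) / lambda n], normalised to vanish at a
    point of [D_rho] where the limit is not [0], would be holomorphic there, with
    real part bounded above by the growth condition (hence [G_n] bounded, by
    Borel-Caratheodory) and at most [o(1)] near that point.  By the two-constants
    estimate [G_n] tends to [0] throughout the disc, so [mu <= 1] there, which
    contradicts [mu > 1] at points with [omega > rho].  The same estimate shows
    that the limit cannot vanish on an open set without vanishing on a whole
    component.

    All of this follows from the maximum principle, which needs only the mean
    value property.  The latter is Goursat's theorem for [z |-> f (a + exp z)]
    on a rectangle of height [2 pi].  It also writes the derivative of an entire
    function as a circular mean of the function, so that this derivative is
    holomorphic and [f' / f] has a primitive where [f] is zero-free. *)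

Require Import Defs.
From Stdlib Require Import Reals Lra List Classical.
From Stdlib Require ClassicalDedekindReals.
From Coquelicot Require Import Coquelicot.
Open Scope R_scope.

(** * Complex derivatives *)

(** The two-constants estimate is obtained without harmonic measure: the quotient $f(z)/(z-c)^p$ is
    studied on closed annuli about $c$, where it has no singularity, and a large $p$ lets the outer
    bound $M$ count for little on smaller circles while the inner bound is taken tiny. The same
    device replaces the Schwarz lemma in the Borel-Caratheodory estimate.

    The limit $g$ is never shown to be continuous, let alone holomorphic; all estimates are made for
    the $f_n$, uniformly in large $n$, and only then passed to $g$ point by point.

    The discs are centred not at the boundary point $z_0$ but at a nearby point $w_1\in D_\rho$ with
    $g(w_1)\neq0$. There $\log|f_n|$ is bounded below, so that subtracting its value at the centre
    costs only $O(1/\lambda_n)$ after division by $\lambda_n$. Since every estimate is concentric,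
    the point $w_2$ with $\omega(w_2)>\rho$ must lie well inside the zero-free region seen from
    $w_1$: bounding $|G_n|$ by its real part divides the radius by 4, and propagating smallness
    divides it by 2 again. *)

Definition Cder (f : C -> C) (z l : C) : Prop :=
  is_derive (K := C_AbsRing) (V := C_NormedModule) f z l.

(** This form has no quotient, hence no exception at $w=z$; the explicit estimates below start from
    it. *)
Lemma Cder_spec (f : C -> C) (z l : C) :
  Cder f z l <->
  (forall eps, 0 < eps -> exists d, 0 < d /\ forall w, Cmod (w - z) < d ->
     Cmod (f w - f z - l * (w - z)) <= eps * Cmod (w - z)).
Proof.
split.
- intros [_ H] eps He.
  destruct (H z (fun P HP => HP) (mkposreal eps He)) as [d Hd].
  exists d; split; [apply cond_pos|].
  intros w Hw.
  specialize (Hd w Hw).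
  unfold norm in Hd; simpl in Hd.
  replace (f w - f z - l * (w - z))%C with (f w - f z + - ((w - z) * l))%C by ring.
  exact Hd.
- intros H; split.
  + apply is_linear_scal_l.
  + intros x Hx eps.
    apply (is_filter_lim_locally_unique (K := C_AbsRing) (V:=AbsRing_NormedModule C_AbsRing)) in Hx; subst x.
    destruct (H eps (cond_pos eps)) as [d [Hd Hd']].
    exists (mkposreal d Hd); intros w Hw.
    unfold norm; simpl.
    specialize (Hd' w Hw).
    match goal with |- Cmod ?a <= _ => replace a with (f w - f z - l * (w - z))%C end.
    exact Hd'.
    unfold minus, plus, opp, scal; simpl. unfold mult; simpl. ring.
Qed.

Lemma Cder_ext_loc (f g : C -> C) z l s :
  0 < s -> (forall w, Cmod (w - z) < s -> f w = g w) -> Cder f z l -> Cder g z l.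
Proof.
intros Hs E H.
apply (is_derive_ext_loc f); [|exact H].
exists (mkposreal s Hs); exact E.
Qed.

Lemma Cder_const (c z : C) : Cder (fun _ => c) z 0%C.
Proof. apply (is_derive_const (K := C_AbsRing) (V := C_NormedModule)). Qed.

Lemma Cder_id (z : C) : Cder (fun w => w) z 1%C.
Proof.
apply Cder_spec; intros eps He; exists 1; split; [lra|]; intros w _.
replace (w - z - 1 * (w - z))%C with (RtoC 0) by ring.
rewrite Cmod_0; apply Rmult_le_pos; [lra | apply Cmod_ge_0].
Qed.

Lemma Cder_plus f g z l m :
  Cder f z l -> Cder g z m -> Cder (fun w => f w + g w)%C z (l + m)%C.
Proof. apply (is_derive_plus (K := C_AbsRing) (V := C_NormedModule)). Qed.

Lemma Cder_minus f g z l m :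
  Cder f z l -> Cder g z m -> Cder (fun w => f w - g w)%C z (l - m)%C.
Proof. apply (is_derive_minus (K := C_AbsRing) (V := C_NormedModule)). Qed.

(** The library's product and chain rules see $\mathbb C$ as a module over itself, through a
    structure other than [C_NormedModule]; the two derivatives have the same content. *)
Lemma Cder_AbsRing (f : C -> C) (z l : C) :
  Cder f z l <-> is_derive (K := C_AbsRing) (V := AbsRing_NormedModule C_AbsRing) f z l.
Proof.
split; intros [_ H]; (split; [apply is_linear_scal_l | exact H]).
Qed.

Lemma Cder_mult f g z l m :
  Cder f z l -> Cder g z m -> Cder (fun w => f w * g w)%C z (l * g z + f z * m)%C.
Proof. intros H1 H2.
apply Cder_AbsRing, (is_derive_mult (K := C_AbsRing) f g z l m).
- apply Cder_AbsRing; exact H1.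
- apply Cder_AbsRing; exact H2.
- exact Cmult_comm.
Qed.

Lemma Cder_comp f g z l m :
  Cder f (g z) l -> Cder g z m -> Cder (fun w => f (g w)) z (m * l)%C.
Proof.
intros Hf Hg; apply (is_derive_comp (K := C_AbsRing) (V := C_NormedModule)); [exact Hf|].
apply Cder_AbsRing; exact Hg.
Qed.

Lemma Cder_cont f z l : Cder f z l ->
  forall eps, 0 < eps -> exists d, 0 < d /\ forall w, Cmod (w - z) < d -> Cmod (f w - f z) < eps.
Proof.
intros H eps He.
destruct (proj1 (Cder_spec f z l) H 1 Rlt_0_1) as [d [Hd H1]].
assert (HM : 0 < 2 + Cmod l) by (generalize (Cmod_ge_0 l); lra).
exists (Rmin d (eps / (2 + Cmod l))); split.
- apply Rmin_pos; [exact Hd | apply Rdiv_lt_0_compat; lra].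
- intros w Hw.
  assert (Hw1 : Cmod (w - z) < d) by (eapply Rlt_le_trans; [exact Hw | apply Rmin_l]).
  assert (Hw2 : Cmod (w - z) < eps / (2 + Cmod l)) by (eapply Rlt_le_trans; [exact Hw | apply Rmin_r]).
  specialize (H1 w Hw1).
  replace (f w - f z)%C with ((f w - f z - l * (w - z)) + l * (w - z))%C by ring.
  eapply Rle_lt_trans; [apply Cmod_triangle|].
  rewrite Cmod_mult.
  apply Rlt_div_r in Hw2; [|lra].
  generalize (Cmod_ge_0 (w - z)); nra.
Qed.

Lemma Cder_inv (z : C) : z <> 0%C -> Cder (fun w => / w)%C z (- / (z * z))%C.
Proof.
intros Hz; apply Cder_spec; intros eps He.
assert (Hm : 0 < Cmod z) by (apply Cmod_gt_0; exact Hz).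
(* The remainder is $(w-z)^2/(wz^2)$. The first bound keeps $|w|>|z|/2$; the second then gives
   $|w-z|\le\varepsilon|w||z|^2$. *)
exists (Rmin (Cmod z / 2) (eps * (Cmod z ^ 3) / 2)); split.
{ apply Rmin_pos; [lra|]. apply Rdiv_lt_0_compat; [|lra].
  apply Rmult_lt_0_compat; [lra | apply pow_lt; lra]. }
intros w Hw.
assert (H1 := Rlt_le_trans _ _ _ Hw (Rmin_l _ _)).
assert (H2 := Rlt_le_trans _ _ _ Hw (Rmin_r _ _)).
assert (Hwm : Cmod z / 2 < Cmod w).
{ assert (T := Cmod_triangle w (- (w - z))).
  replace (w + - (w - z))%C with z in T by ring.
  rewrite Cmod_opp in T. lra. }
assert (Hw0 : w <> 0%C) by (apply Cmod_gt_0; lra).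
replace (/ w - / z - - / (z * z) * (w - z))%C with ((w - z) * ((w - z) * / (w * (z * z))))%C
  by (field; auto).
rewrite Cmod_mult, (Rmult_comm eps).
apply Rmult_le_compat_l; [apply Cmod_ge_0|].
rewrite Cmod_mult, Cmod_inv by (repeat apply Cmult_neq_0; auto).
rewrite !Cmod_mult.
assert (Hz2 : 0 < Cmod z * Cmod z) by (apply Rmult_lt_0_compat; exact Hm).
apply Rle_div_l; [apply Rmult_lt_0_compat; lra|].
apply Rle_trans with (eps * (Cmod z / 2 * (Cmod z * Cmod z))).
- simpl in H2; lra.
- apply Rmult_le_compat_l; [lra|]; apply Rmult_le_compat_r; lra.
Qed.

Lemma Cder_div (f g : C -> C) z l m : g z <> 0%C ->
  Cder f z l -> Cder g z m ->
  Cder (fun w => f w / g w)%C z (l * / g z + f z * (m * - / (g z * g z)))%C.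
Proof.
intros Hz Hf Hg.
apply (Cder_mult f (fun w => / g w)%C); [exact Hf|].
apply (Cder_comp Cinv g); [apply Cder_inv; exact Hz | exact Hg].
Qed.

Global Opaque Cder.

Lemma Cder_ext (f g : C -> C) z l : (forall w, f w = g w) -> Cder f z l -> Cder g z l.
Proof. intros E; apply (Cder_ext_loc _ _ _ _ 1 Rlt_0_1); intros w _; apply E. Qed.

Lemma Cder_pow (z : C) (p : nat) : exists l, Cder (fun w => w ^ p)%C z l.
Proof.
induction p as [|p [l IH]].
- exists 0%C. apply (Cder_ext (fun _ => 1%C)); [reflexivity | apply Cder_const].
- exists (1 * z ^ p + z * l)%C.
  apply (Cder_ext (fun w => w * w ^ p)%C); [reflexivity|].
  apply (Cder_mult (fun w => w) (fun w => w ^ p)%C); [apply Cder_id | exact IH].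
Qed.

Lemma Cder_val f z l m : Cder f z l -> l = m -> Cder f z m.
Proof. intros H <-; exact H. Qed.

(** * Integrals of complex-valued functions of a real variable *)

Definition Ccont (h : R -> C) (x : R) : Prop :=
  continuous (T := R_UniformSpace) (U := C_UniformSpace) h x.

Lemma Ccont_spec h x : Ccont h x <->
  forall eps, 0 < eps -> exists d, 0 < d /\ forall y, Rabs (y - x) < d -> Cmod (h y - h x) < eps.
Proof.
split.
- intros H eps He.
  assert (He2 : 0 < eps / 2) by lra.
  destruct (proj1 (filterlim_locally _ _) H (mkposreal _ He2)) as [d Hd].
  exists d; split; [apply cond_pos|]; intros y Hy.
  destruct (Hd y Hy) as [H1 H2].
  assert (T := C_NormedModule_mixin_compat2 (h x) (h y) (mkposreal _ He2) (conj H1 H2)).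
  eapply Rlt_le_trans; [exact T|]. simpl.
  assert (sqrt 2 <= 2). { rewrite <- (sqrt_square 2) at 2 by lra. apply sqrt_le_1; lra. }
  nra.
- intros H. apply filterlim_locally; intros eps.
  destruct (H eps (cond_pos eps)) as [d [Hd Hd']].
  exists (mkposreal d Hd); intros y Hy.
  apply C_NormedModule_mixin_compat1. apply (Hd' y Hy).
Qed.

Definition CInt (h : R -> C) (a b : R) : C := RInt (V := C_R_CompleteNormedModule) h a b.

Definition Ccont_on (h : R -> C) (a b : R) := forall x, Rmin a b <= x <= Rmax a b -> Ccont h x.

Lemma ex_CInt h a b : Ccont_on h a b -> ex_RInt (V := C_R_CompleteNormedModule) h a b.
Proof. intros H; apply (ex_RInt_continuous (V := C_R_CompleteNormedModule)); exact H. Qed.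

Lemma CInt_Chasles h a b c : Ccont_on h a b -> Ccont_on h b c ->
  (CInt h a b + CInt h b c)%C = CInt h a c.
Proof.
intros H1 H2; apply (RInt_Chasles (V := C_R_CompleteNormedModule)); apply ex_CInt; assumption.
Qed.

Lemma CInt_swap h a b : Ccont_on h a b -> CInt h b a = (- CInt h a b)%C.
Proof.
intros H; symmetry; apply (opp_RInt_swap (V := C_R_CompleteNormedModule)), ex_CInt, H.
Qed.

Lemma Cmod_norm_R (z : C) : norm (K := R_AbsRing) (V := C_R_NormedModule) z = Cmod z.
Proof.
destruct z as [x y]; unfold norm; simpl; unfold prod_norm, norm, Cmod; simpl; unfold abs; simpl.
rewrite !Rmult_1_r; f_equal; f_equal; symmetry; apply (Rsqr_abs _).
Qed.

Lemma CInt_minus h k a b : Ccont_on h a b -> Ccont_on k a b ->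
  CInt (fun x => h x - k x)%C a b = (CInt h a b - CInt k a b)%C.
Proof.
intros H1 H2; apply (RInt_minus (V := C_R_CompleteNormedModule)); apply ex_CInt; assumption.
Qed.

Lemma CInt_ext h k a b : (forall x, Rmin a b < x < Rmax a b -> h x = k x) -> CInt h a b = CInt k a b.
Proof. apply (RInt_ext (V := C_R_CompleteNormedModule)). Qed.

Lemma CInt_const (c : C) a b : CInt (fun _ => c) a b = (RtoC (b - a) * c)%C.
Proof. unfold CInt; rewrite (RInt_const (V := C_R_CompleteNormedModule)). apply scal_R_Cmult. Qed.

Lemma CInt_bound h a b M : a <= b -> Ccont_on h a b ->
  (forall x, a <= x <= b -> Cmod (h x) <= M) -> Cmod (CInt h a b) <= (b - a) * M.
Proof.
intros Hab Hc HM.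
rewrite <- Cmod_norm_R; apply (norm_RInt_le_const (V := C_R_CompleteNormedModule) h a b (CInt h a b) M Hab).
- intros x Hx; apply Rle_trans with (Cmod (h x)); [right; apply (Cmod_norm_R (h x)) | exact (HM x Hx)].
- apply (RInt_correct (V := C_R_CompleteNormedModule)), ex_CInt, Hc.
Qed.

(** The integral lives in $\mathbb C$ as a real vector space, where linearity only covers real
    factors; a complex factor is treated through real and imaginary parts. *)
Lemma CInt_scal (c : C) h a b : Ccont_on h a b -> CInt (fun x => c * h x)%C a b = (c * CInt h a b)%C.
Proof.
intros H.
apply ex_CInt, (RInt_correct (V := C_R_CompleteNormedModule)) in H.
apply (is_RInt_unique (V := C_R_CompleteNormedModule)).
change (@RInt C_R_CompleteNormedModule h a b) with (CInt h a b) in H.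
assert (H1 := is_RInt_fct_extend_fst _ _ _ _ H).
assert (H2 := is_RInt_fct_extend_snd _ _ _ _ H).
unfold Cmult.
apply (is_RInt_fct_extend_pair (U := R_NormedModule) (V := R_NormedModule)); simpl.
- apply (is_RInt_minus (V := R_NormedModule)); apply (is_RInt_scal (V := R_NormedModule)); assumption.
- apply (is_RInt_plus (V := R_NormedModule)); apply (is_RInt_scal (V := R_NormedModule)); assumption.
Qed.

Lemma CInt_Re h a b : Ccont_on h a b -> is_RInt (V := R_NormedModule) (fun x => Re (h x)) a b (Re (CInt h a b)).
Proof.
intros H.
apply (is_RInt_fct_extend_fst (U := R_NormedModule) (V := R_NormedModule)).
apply (RInt_correct (V := C_R_CompleteNormedModule)), ex_CInt, H.
Qed.

(** * Complex derivatives along real lines and the fundamental theorem of calculus *)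

Lemma Cder_cont_line f z0 h t l : Cder f (z0 + RtoC t * h)%C l ->
  Ccont (fun s => f (z0 + RtoC s * h)%C) t.
Proof.
intros H; apply Ccont_spec; intros eps He.
destruct (Cder_cont _ _ _ H eps He) as [d [Hd Hd']].
(* One is added because the direction $h$ may be $0$. *)
assert (Hh : 0 < 1 + Cmod h) by (generalize (Cmod_ge_0 h); lra).
exists (d / (1 + Cmod h)); split; [apply Rdiv_lt_0_compat; lra|].
intros y Hy; apply Hd'.
replace (z0 + y * h - (z0 + t * h))%C with (RtoC (y - t) * h)%C by (rewrite RtoC_minus; ring).
rewrite Cmod_mult, Cmod_R.
apply Rlt_div_r in Hy; [|lra].
generalize (Rabs_pos (y - t)) (Cmod_ge_0 h); nra.
Qed.

Lemma Cder_line f z0 h t l : Cder f (z0 + RtoC t * h)%C l ->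
  is_derive (K := R_AbsRing) (V := C_R_NormedModule) (fun s => f (z0 + RtoC s * h)%C) t (l * h)%C.
Proof.
intros H; split; [apply is_linear_scal_l|].
intros x Hx eps.
apply (is_filter_lim_locally_unique (K := R_AbsRing) (V:=R_NormedModule)) in Hx; subst x.
assert (Hh : 0 < 1 + Cmod h) by (generalize (Cmod_ge_0 h); lra).
destruct (proj1 (Cder_spec _ _ _) H (eps / (1 + Cmod h))) as [d [Hd Hd']].
{ apply Rdiv_lt_0_compat; [apply cond_pos | lra]. }
assert (Hdd : 0 < d / (1 + Cmod h)) by (apply Rdiv_lt_0_compat; lra).
exists (mkposreal _ Hdd); intros s Hs.
change (Rabs (s - t) < d / (1 + Cmod h)) in Hs.
rewrite Cmod_norm_R.
change (norm (minus s t)) with (Rabs (s - t)).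
specialize (Hd' (z0 + s * h)%C).
replace (z0 + s * h - (z0 + t * h))%C with (RtoC (s - t) * h)%C in Hd' by (rewrite RtoC_minus; ring).
rewrite Cmod_mult, Cmod_R in Hd'.
apply Rlt_div_r in Hs; [|lra].
assert (A : Cmod (f (z0 + s * h)%C - f (z0 + t * h)%C - l * (RtoC (s - t) * h)) <= eps / (1 + Cmod h) * (Rabs (s - t) * Cmod h)).
{ apply Hd'. generalize (Rabs_pos (s - t)) (Cmod_ge_0 h); nra. }
match goal with |- Cmod ?a <= _ => replace a with (f (z0 + s * h)%C - f (z0 + t * h)%C - l * (RtoC (s - t) * h))%C end.
- eapply Rle_trans; [exact A|].
  unfold Rdiv; rewrite Rmult_assoc; apply Rmult_le_compat_l; [apply Rlt_le, cond_pos|].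
  apply Rmult_le_reg_l with (1 + Cmod h); [lra|]. rewrite <- Rmult_assoc, Rinv_r, Rmult_1_l by lra.
  generalize (Rabs_pos (s - t)); nra.
- change (minus s t) with (s - t).
  change (scal (V := C_R_NormedModule) (s - t) (l * h)%C) with (scal (V := C_R_ModuleSpace) (s - t) (l * h)%C).
  rewrite scal_R_Cmult. unfold minus, plus, opp; simpl.
  change ((f (z0 + s * h) - f (z0 + t * h) - l * ((s - t)%R * h))%C = (f (z0 + s * h) + - f (z0 + t * h) + - (RtoC (s - t)%R * (l * h)))%C); ring.
Qed.

Lemma CInt_line F f z0 h a b :
  (forall t, Rmin a b <= t <= Rmax a b -> Cder F (z0 + RtoC t * h)%C (f (z0 + RtoC t * h)%C)) ->
  Ccont_on (fun t => f (z0 + RtoC t * h)%C * h)%C a b ->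
  CInt (fun t => f (z0 + RtoC t * h)%C * h)%C a b = (F (z0 + RtoC b * h)%C - F (z0 + RtoC a * h)%C)%C.
Proof.
intros HF Hc; apply (is_RInt_unique (V := C_R_CompleteNormedModule)).
apply (is_RInt_derive (V := C_R_CompleteNormedModule) (fun t => F (z0 + RtoC t * h)%C)).
- intros x Hx; apply Cder_line, HF, Hx.
- exact Hc.
Qed.

(** * Goursat's theorem on rectangles *)

(** Bisection: if $P$ failed, nested failing quarters would shrink to a point $(p,q)$ and contradict
    the local hypothesis there. It serves both Goursat's theorem and the compactness of
    rectangles. *)
Lemma rect_induction (P : R -> R -> R -> R -> Prop) (A B C D : R) :
  A <= B -> C <= D ->
  (forall a b c d, A <= a <= b -> b <= B -> C <= c <= d -> d <= D ->
     P a ((a + b) / 2) c ((c + d) / 2) -> P a ((a + b) / 2) ((c + d) / 2) d ->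
     P ((a + b) / 2) b c ((c + d) / 2) -> P ((a + b) / 2) b ((c + d) / 2) d ->
     P a b c d) ->
  (forall p q, A <= p <= B -> C <= q <= D -> exists delta, 0 < delta /\
     forall a b c d, A <= a <= p -> p <= b <= B -> C <= c <= q -> q <= d <= D ->
       b - a < delta -> d - c < delta -> P a b c d) ->
  P A B C D.
Proof.
intros HAB HCD H4 Hloc.
(* An informative decision is required, since the failing quarter is chosen by a recursive
   function. *)
assert (dec : forall a b c d, {P a b c d} + {~ P a b c d}).
{ intros a b c d; destruct (ClassicalDedekindReals.sig_not_dec (P a b c d)) as [H|H]; [left; apply NNPP, H | right; exact H]. }
destruct (dec A B C D) as [H|Hn]; [exact H | exfalso].
(* The first failing quarter; the fourth is taken by default, and must fail when the other three
   hold. *)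
pose (step := fun s : (R * R) * (R * R) =>
  let '((a, b), (c, d)) := s in
  let m := (a + b) / 2 in let n := (c + d) / 2 in
  if dec a m c n then if dec a m n d then if dec m b c n
  then ((m, b), (n, d)) else ((m, b), (c, n)) else ((a, m), (n, d)) else ((a, m), (c, n))).
pose (s := fix s n := match n with O => ((A, B), (C, D)) | S k => step (s k) end).
pose (sa := fun n => fst (fst (s n))). pose (sb := fun n => snd (fst (s n))).
pose (sc := fun n => fst (snd (s n))). pose (sd := fun n => snd (snd (s n))).
assert (Hinv : forall n, A <= sa n <= sb n /\ sb n <= B /\ C <= sc n <= sd n /\ sd n <= D /\
   ~ P (sa n) (sb n) (sc n) (sd n) /\
   sb n - sa n = (B - A) * (/ 2) ^ n /\ sd n - sc n = (D - C) * (/ 2) ^ n).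
{ induction n as [|n IH].
  - unfold sa, sb, sc, sd; simpl. repeat split; try lra. exact Hn.
  - unfold sa, sb, sc, sd in *; simpl.
    destruct (s n) as [[a b] [c d]]; simpl in *.
    destruct IH as (I1 & I2 & I3 & I4 & I5 & I6 & I7).
    assert (H4' := H4 a b c d I1 I2 I3 I4).
    destruct (dec a ((a + b) / 2) c ((c + d) / 2));
    [destruct (dec a ((a + b) / 2) ((c + d) / 2) d);
     [destruct (dec ((a + b) / 2) b c ((c + d) / 2))|]|]; simpl;
    repeat split; try lra; try assumption.
    intros H; apply I5, H4'; assumption. }
assert (Hmon : forall n, sa n <= sa (S n) /\ sb (S n) <= sb n /\ sc n <= sc (S n) /\ sd (S n) <= sd n).
{ intros n; destruct (Hinv n) as (I1 & _ & I3 & _).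
  unfold sa, sb, sc, sd in *; simpl.
  destruct (s n) as [[a b] [c d]]; simpl in *.
  destruct (dec a ((a + b) / 2) c ((c + d) / 2));
    [destruct (dec a ((a + b) / 2) ((c + d) / 2) d);
     [destruct (dec ((a + b) / 2) b c ((c + d) / 2))|]|]; simpl; lra. }
assert (Hhalf : is_lim_seq (fun n => (/ 2) ^ n) 0).
{ apply is_lim_seq_geom; rewrite Rabs_pos_eq; lra. }
assert (Hz : forall x, is_lim_seq (fun n => x * (/ 2) ^ n) 0).
{ intros x; replace (Finite 0) with (Rbar_mult x 0) by (simpl; f_equal; ring).
  apply is_lim_seq_scal_l, Hhalf. }
assert (Hlim : forall u v x, (forall n, u n <= u (S n)) -> (forall n, v (S n) <= v n) ->
   (forall n, v n - u n = x * (/ 2) ^ n) -> exists l, forall n, u n <= l <= v n).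
{ intros u v x Hu Hv Hx.
  destruct (ex_lim_seq_adj u v Hu Hv) as [[l Hl] [[l' Hl'] E]].
  - apply is_lim_seq_ext with (fun n => x * (/ 2) ^ n); [intros n; symmetry; apply Hx | apply Hz].
  - rewrite (is_lim_seq_unique _ _ Hl), (is_lim_seq_unique _ _ Hl') in E.
    injection E as E; subst l'.
    exists l; intros n; split.
    + exact (is_lim_seq_incr_compare u l Hl Hu n).
    + exact (is_lim_seq_decr_compare v l Hl' Hv n). }
destruct (Hlim sa sb (B - A)) as [p Hp]; try (intros n; apply Hmon); try (intros n; apply Hinv).
destruct (Hlim sc sd (D - C)) as [q Hq]; try (intros n; apply Hmon); try (intros n; apply Hinv).
destruct (Hloc p q) as [delta [Hd Hd']].
{ specialize (Hp O); unfold sa, sb in Hp; simpl in Hp; exact Hp. }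
{ specialize (Hq O); unfold sc, sd in Hq; simpl in Hq; exact Hq. }
assert (Ev : forall x, eventually (fun n => x * (/ 2) ^ n < delta)).
{ intros x. destruct (proj2 (is_lim_seq_spec _ _) (Hz x) (mkposreal _ Hd)) as [N HN].
  exists N; intros n Hn'. specialize (HN n Hn'); simpl in HN.
  apply Rabs_def2 in HN; lra. }
destruct (filter_and _ _ (Ev (B - A)) (Ev (D - C))) as [N HN].
destruct (HN N (le_n N)) as [HN1 HN2].
destruct (Hinv N) as (I1 & I2 & I3 & I4 & I5 & I6 & I7).
specialize (Hp N); specialize (Hq N).
apply I5, Hd'; lra.
Qed.

Lemma Ccont_ext h k x : (forall y, h y = k y) -> Ccont h x -> Ccont k x.
Proof. intros E; apply continuous_ext, E. Qed.

Lemma hline (x c : R) : ((0, c) + RtoC x * 1)%C = (x, c).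
Proof. unfold RtoC, Cplus, Cmult; simpl; f_equal; ring. Qed.

Lemma vline (y c : R) : (RtoC c + RtoC y * Ci)%C = (c, y).
Proof. unfold RtoC, Ci, Cplus, Cmult; simpl; f_equal; ring. Qed.

Lemma Cder_cont_h f (x c : R) l : Cder f (x, c) l -> Ccont (fun s => f (s, c)) x.
Proof.
intros H; rewrite <- hline in H; apply Cder_cont_line in H.
revert H; apply Ccont_ext; intros y; rewrite hline; reflexivity.
Qed.

Lemma Cder_cont_v f (y c : R) l : Cder f (c, y) l -> Ccont (fun s => f (c, s)) y.
Proof.
intros H; rewrite <- vline in H; apply Cder_cont_line in H.
revert H; apply Ccont_ext; intros s; rewrite vline; reflexivity.
Qed.

Lemma Ccont_scal (c : C) h x : Ccont h x -> Ccont (fun s => c * h s)%C x.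
Proof.
intros H; apply Ccont_spec; intros eps He.
assert (Hc : 0 < 1 + Cmod c) by (generalize (Cmod_ge_0 c); lra).
destruct (proj1 (Ccont_spec _ _) H (eps / (1 + Cmod c))) as [d [Hd Hd']].
{ apply Rdiv_lt_0_compat; lra. }
exists d; split; [exact Hd|]; intros y Hy; specialize (Hd' y Hy).
replace (c * h y - c * h x)%C with (c * (h y - h x))%C by ring.
rewrite Cmod_mult; apply Rlt_div_r in Hd'; [|lra].
generalize (Cmod_ge_0 (h y - h x)); nra.
Qed.

Definition holo_on (f : C -> C) (D : C -> Prop) : Prop := forall z, D z -> exists l, Cder f z l.

Definition rect (a b c d : R) (z : C) : Prop := a <= fst z <= b /\ c <= snd z <= d.

(** The counterclockwise contour integral over the boundary, with $dz=dx$ on horizontal sides and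
    $dz=i\,dy$ on vertical ones. *)
Definition rect_int (f : C -> C) (a b c d : R) : C :=
  (CInt (fun x => f (x, c)) a b - CInt (fun x => f (x, d)) a b
   + Ci * (CInt (fun y => f (b, y)) c d - CInt (fun y => f (a, y)) c d))%C.

Lemma holo_cont_h f a b c d x0 x1 y : holo_on f (rect a b c d) ->
  a <= x0 <= b -> a <= x1 <= b -> c <= y <= d -> Ccont_on (fun x => f (x, y)) x0 x1.
Proof.
intros H H1 H2 H3 x Hx. destruct (H (x, y)) as [l Hl]; [|exact (Cder_cont_h _ _ _ _ Hl)].
split; simpl; [|lra]. revert Hx; unfold Rmin, Rmax; destruct Rle_dec; lra.
Qed.

Lemma holo_cont_v f a b c d y0 y1 x : holo_on f (rect a b c d) ->
  c <= y0 <= d -> c <= y1 <= d -> a <= x <= b -> Ccont_on (fun y => f (x, y)) y0 y1.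
Proof.
intros H H1 H2 H3 y Hy. destruct (H (x, y)) as [l Hl]; [|exact (Cder_cont_v _ _ _ _ Hl)].
split; simpl; [lra|]. revert Hy; unfold Rmin, Rmax; destruct Rle_dec; lra.
Qed.

(** The inner sides are traversed twice, in opposite directions. *)
Lemma rect_int_split f a b c d : a <= b -> c <= d -> holo_on f (rect a b c d) ->
  let m := (a + b) / 2 in let n := (c + d) / 2 in
  rect_int f a b c d = (rect_int f a m c n + rect_int f a m n d + rect_int f m b c n + rect_int f m b n d)%C.
Proof.
intros Hab Hcd H m n.
assert (Hm : a <= m <= b) by (unfold m; lra).
assert (Hn : c <= n <= d) by (unfold n; lra).
assert (Hh : forall y, c <= y <= d -> CInt (fun x => f (x, y)) a b =
  (CInt (fun x => f (x, y)) a m + CInt (fun x => f (x, y)) m b)%C).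
{ intros y Hy; symmetry; apply CInt_Chasles; apply (holo_cont_h f a b c d); try assumption; lra. }
assert (Hv : forall x, a <= x <= b -> CInt (fun y => f (x, y)) c d =
  (CInt (fun y => f (x, y)) c n + CInt (fun y => f (x, y)) n d)%C).
{ intros x Hx; symmetry; apply CInt_Chasles; apply (holo_cont_v f a b c d); try assumption; lra. }
unfold rect_int.
rewrite (Hh c), (Hh d), (Hv a), (Hv b) by lra.
ring.
Qed.

Lemma rect_int_minus f g a b c d : a <= b -> c <= d ->
  holo_on f (rect a b c d) -> holo_on g (rect a b c d) ->
  rect_int (fun z => f z - g z)%C a b c d = (rect_int f a b c d - rect_int g a b c d)%C.
Proof.
intros Hab Hcd Hf Hg; unfold rect_int.
assert (Hh : forall y, c <= y <= d -> CInt (fun x => f (x, y) - g (x, y))%C a b =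
  (CInt (fun x => f (x, y)) a b - CInt (fun x => g (x, y)) a b)%C).
{ intros y Hy; apply (CInt_minus (fun x => f (x, y)) (fun x => g (x, y)));
  apply (holo_cont_h _ a b c d); try assumption; lra. }
assert (Hv : forall x, a <= x <= b -> CInt (fun y => f (x, y) - g (x, y))%C c d =
  (CInt (fun y => f (x, y)) c d - CInt (fun y => g (x, y)) c d)%C).
{ intros x Hx; apply (CInt_minus (fun y => f (x, y)) (fun y => g (x, y)));
  apply (holo_cont_v _ a b c d); try assumption; lra. }
rewrite (Hh c), (Hh d), (Hv a), (Hv b) by lra.
ring.
Qed.

Lemma CInt_h F f a b y : a <= b ->
  (forall x, a <= x <= b -> Cder F (x, y) (f (x, y)) /\ exists l, Cder f (x, y) l) ->
  CInt (fun x => f (x, y)) a b = (F (b, y) - F (a, y))%C.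
Proof.
intros Hab H. rewrite <- (hline b y), <- (hline a y).
rewrite <- (CInt_line F f).
- apply CInt_ext; intros x _; rewrite hline; ring.
- rewrite Rmin_left, Rmax_right by lra; intros t Ht; rewrite hline; apply H, Ht.
- intros t; rewrite Rmin_left, Rmax_right by lra; intros Ht.
  destruct (H t Ht) as [_ [l Hl]].
  apply (Ccont_ext (fun s => f (s, y))); [intros s; rewrite hline; ring|].
  exact (Cder_cont_h _ _ _ _ Hl).
Qed.

Lemma CInt_v F f c d x : c <= d ->
  (forall y, c <= y <= d -> Cder F (x, y) (f (x, y)) /\ exists l, Cder f (x, y) l) ->
  (Ci * CInt (fun y => f (x, y)) c d)%C = (F (x, d) - F (x, c))%C.
Proof.
intros Hab H. rewrite <- (vline d x), <- (vline c x).
assert (Hc : Ccont_on (fun y => f (x, y)) c d).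
{ intros t; rewrite Rmin_left, Rmax_right by lra; intros Ht.
  destruct (H t Ht) as [_ [l Hl]]; exact (Cder_cont_v _ _ _ _ Hl). }
rewrite <- (CInt_line F f).
- rewrite <- CInt_scal by exact Hc.
  apply CInt_ext; intros t _; rewrite vline; ring.
- rewrite Rmin_left, Rmax_right by lra; intros t Ht; rewrite vline; apply H, Ht.
- intros t Ht.
  apply (Ccont_ext (fun s => Ci * f (x, s))%C); [intros s; rewrite vline; ring|].
  apply Ccont_scal, Hc, Ht.
Qed.

Lemma rect_int_primitive F f a b c d : a <= b -> c <= d ->
  (forall z, rect a b c d z -> Cder F z (f z)) -> holo_on f (rect a b c d) ->
  rect_int f a b c d = 0%C.
Proof.
intros Hab Hcd HF Hf; unfold rect_int.
assert (HH : forall x y, a <= x <= b -> c <= y <= d -> Cder F (x, y) (f (x, y)) /\ exists l, Cder f (x, y) l).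
{ intros x y Hx Hy; split; [apply HF | apply Hf]; split; assumption. }
rewrite (CInt_h F f a b c), (CInt_h F f a b d) by (try assumption; intros; apply HH; lra).
replace (Ci * (CInt (fun y : R => f (b, y)) c d - CInt (fun y : R => f (a, y)) c d))%C with
 (Ci * CInt (fun y : R => f (b, y)) c d - Ci * CInt (fun y : R => f (a, y)) c d)%C by ring.
rewrite (CInt_v F f c d a), (CInt_v F f c d b) by (try assumption; intros; apply HH; lra).
ring.
Qed.

Lemma Cder_affine (al be p z : C) : Cder (fun w => al + be * (w - p))%C z be.
Proof.
assert (H := Cder_plus _ _ z _ _ (Cder_const al z)
  (Cder_mult _ _ z _ _ (Cder_const be z) (Cder_minus _ _ z _ _ (Cder_id z) (Cder_const p z)))).
eapply Cder_val; [exact H | cbv beta; ring].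
Qed.

Lemma rect_int_affine (al be p : C) a b c d : a <= b -> c <= d ->
  rect_int (fun w => al + be * (w - p))%C a b c d = 0%C.
Proof.
intros Hab Hcd.
apply (rect_int_primitive (fun w => al * (w - p) + be * / 2 * ((w - p) * (w - p)))%C); try assumption.
- intros z _.
  assert (H0 := Cder_minus _ _ z _ _ (Cder_id z) (Cder_const p z)).
  assert (H := Cder_plus _ _ z _ _ (Cder_mult _ _ z _ _ (Cder_const al z) H0)
   (Cder_mult _ _ z _ _ (Cder_const (be * / 2)%C z) (Cder_mult _ _ z _ _ H0 H0))).
  eapply Cder_val; [exact H|].
  cbv beta; field. 
- intros z _; exists be; apply Cder_affine.
Qed.

Lemma rect_int_bound f a b c d M : a <= b -> c <= d -> holo_on f (rect a b c d) ->
  (forall z, rect a b c d z -> Cmod (f z) <= M) ->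
  Cmod (rect_int f a b c d) <= 2 * (b - a + (d - c)) * M.
Proof.
intros Hab Hcd Hf HM; unfold rect_int.
assert (Hh : forall y, c <= y <= d -> Cmod (CInt (fun x => f (x, y)) a b) <= (b - a) * M).
{ intros y Hy; apply CInt_bound; [lra| |].
  - apply (holo_cont_h f a b c d); [exact Hf|lra|lra|lra].
  - intros x Hx; apply HM; split; assumption. }
assert (Hv : forall x, a <= x <= b -> Cmod (CInt (fun y => f (x, y)) c d) <= (d - c) * M).
{ intros y Hy; apply CInt_bound; [lra| |].
  - apply (holo_cont_v f a b c d); [exact Hf|lra|lra|lra].
  - intros x Hx; apply HM; split; assumption. }
eapply Rle_trans; [apply Cmod_triangle|]. rewrite Cmod_mult, Cmod_Ci, Rmult_1_l.
unfold Cminus.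
eapply Rle_trans; [apply Rplus_le_compat; apply Cmod_triangle|]. rewrite !Cmod_opp.
assert (H1 := Hh c ltac:(lra)). assert (H2 := Hh d ltac:(lra)).
assert (H3 := Hv a ltac:(lra)). assert (H4 := Hv b ltac:(lra)).
lra.
Qed.

Lemma Cmod_le_abs (x y : R) : Cmod (x, y) <= Rabs x + Rabs y.
Proof.
replace (x, y) with (RtoC x + RtoC y * Ci)%C by (rewrite vline; reflexivity).
eapply Rle_trans; [apply Cmod_triangle|].
rewrite Cmod_mult, Cmod_Ci, !Cmod_R; lra.
Qed.

(** With $S$ the half-perimeter, the bound $2\varepsilon S^2$ passes from the quarters to the whole
    exactly, as each quarter contributes a fourth of it. Near a point the affine part of $f$
    integrates to $0$ and the remainder is at most $\varepsilon S$ on a contour of length $2S$. *)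
Theorem Goursat f a b c d : a <= b -> c <= d -> holo_on f (rect a b c d) ->
  rect_int f a b c d = 0%C.
Proof.
intros Hab Hcd Hf.
apply Cmod_eq_0.
assert (Hsub : forall a' b' c' d', a <= a' <= b' -> b' <= b -> c <= c' <= d' -> d' <= d -> holo_on f (rect a' b' c' d')).
{ intros a' b' c' d' H1 H2 H3 H4 z [Hz1 Hz2]; apply Hf; split; lra. }
assert (Hall : forall eps, 0 < eps -> Cmod (rect_int f a b c d) <= 2 * eps * (b - a + (d - c)) ^ 2).
{ intros eps He.
  apply (rect_induction (fun a b c d => Cmod (rect_int f a b c d) <= 2 * eps * (b - a + (d - c)) ^ 2)); try assumption.
  - intros a' b' c' d' H1 H2 H3 H4 P1 P2 P3 P4.
    rewrite rect_int_split by (try apply Hsub; lra).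
    eapply Rle_trans; [apply Cmod_triangle|].
    eapply Rle_trans; [apply Rplus_le_compat_r, Cmod_triangle|].
    eapply Rle_trans; [apply Rplus_le_compat_r, Rplus_le_compat_r, Cmod_triangle|].
    nra.
  - intros p q Hp Hq.
    destruct (Hf (p, q)) as [l Hl]; [split; assumption|].
    destruct (proj1 (Cder_spec _ _ _) Hl eps He) as [dl [Hdl Hd']].
    (* Both sides are shorter than [dl / 2], so every point of the rectangle is within [dl] of
       $(p,q)$. *)
    exists (dl / 2); split; [lra|].
    intros a' b' c' d' H1 H2 H3 H4 H5 H6.
    assert (Haff : holo_on (fun w => f (p, q) + l * (w - (p, q)))%C (rect a' b' c' d')).
    { intros z _; exists l; apply Cder_affine. }
    assert (E := rect_int_minus f _ a' b' c' d' ltac:(lra) ltac:(lra) ltac:(apply Hsub; lra) Haff).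
    rewrite rect_int_affine in E by lra.
    replace (rect_int f a' b' c' d') with (rect_int f a' b' c' d' - 0)%C by ring.
    rewrite <- E.
    eapply Rle_trans; [apply (rect_int_bound _ a' b' c' d' (eps * (b' - a' + (d' - c')))); try lra|].
    + intros z Hz. destruct (Hsub a' b' c' d' ltac:(lra) ltac:(lra) ltac:(lra) ltac:(lra) z Hz) as [m Hm].
      destruct (Haff z Hz) as [k Hk]. exists (m - k)%C. apply Cder_minus; assumption.
    + intros [x y] [Hx Hy]; simpl in Hx, Hy.
      assert (Hw : Cmod ((x, y) - (p, q))%C <= b' - a' + (d' - c')).
      { eapply Rle_trans; [apply (Cmod_le_abs (x + - p) (y + - q))|].
        apply Rplus_le_compat; apply Rabs_le; lra. }
      replace (f (x, y) - (f (p, q) + l * ((x, y) - (p, q))))%C with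
        (f (x, y) - f (p, q) - l * ((x, y) - (p, q)))%C by ring.
      eapply Rle_trans; [apply Hd'; lra|].
      apply Rmult_le_compat_l; lra.
    + simpl; lra. }
apply Rle_antisym; [|apply Cmod_ge_0].
apply le_epsilon; intros eps He; rewrite Rplus_0_l.
set (S := b - a + (d - c)) in *.
(* [S ^ 2 + 1] instead of [S ^ 2], which is $0$ for a rectangle reduced to a point. *)
assert (HS : 0 < 2 * (S ^ 2 + 1)) by nra.
eapply Rle_trans; [apply (Hall (eps / (2 * (S ^ 2 + 1))))|].
- apply Rdiv_lt_0_compat; lra.
- replace (2 * (eps / (2 * (S ^ 2 + 1))) * S ^ 2) with (eps * (S ^ 2 / (S ^ 2 + 1))) by (field; nra).
  rewrite <- (Rmult_1_r eps) at 2. apply Rmult_le_compat_l; [lra|].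
  apply Rle_div_l; nra.
Qed.

(** * The mean value property *)

Definition cis (t : R) : C := (cos t, sin t).
Definition cexp (z : C) : C := (RtoC (exp (fst z)) * cis (snd z))%C.

Lemma Cmod_cis t : Cmod (cis t) = 1.
Proof.
unfold Cmod, cis; cbn [fst snd]; rewrite <- sqrt_1; f_equal.
generalize (sin2_cos2 t); unfold Rsqr; simpl; lra.
Qed.

Lemma cis_nz t : cis t <> 0%C.
Proof. apply Cmod_gt_0; rewrite Cmod_cis; lra. Qed.

Lemma cis_plus s t : cis (s + t) = (cis s * cis t)%C.
Proof. unfold cis, Cmult; simpl; rewrite cos_plus, sin_plus; f_equal; ring. Qed.

Lemma cexp_plus z w : cexp (z + w)%C = (cexp z * cexp w)%C.
Proof.
unfold cexp; destruct z as [x y], w as [u v]; simpl.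
rewrite exp_plus, cis_plus, RtoC_mult; ring.
Qed.

Lemma Cmod_cexp z : Cmod (cexp z) = exp (fst z).
Proof.
unfold cexp; rewrite Cmod_mult, Cmod_cis, Cmod_R, Rabs_pos_eq; [ring|].
apply Rlt_le, exp_pos.
Qed.

Lemma derivable_0_bound f l : derivable_pt_lim f 0 l ->
  forall eps, 0 < eps -> exists d, 0 < d /\ forall h, Rabs h < d -> Rabs (f h - f 0 - l * h) <= eps * Rabs h.
Proof.
intros H eps He; destruct (H eps He) as [d Hd].
exists d; split; [apply cond_pos|]; intros h Hh.
destruct (Req_dec h 0) as [->|Hn].
- rewrite Rmult_0_r, !Rminus_diag, Rabs_R0; lra.
- specialize (Hd h Hn Hh); rewrite Rplus_0_l in Hd.
  replace (f h - f 0 - l * h) with (((f h - f 0) / h - l) * h) by (field; exact Hn).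
  rewrite Rabs_mult; apply Rmult_le_compat_r; [apply Rabs_pos | lra].
Qed.

(** The functional equation carries the derivative at $0$ to every point. At $0$ the real part is
    split as $(e^u-1-u)+e^u(\cos v-1)$ and the imaginary part as $e^u(\sin v-v)+(e^u-1)v$. *)
Lemma Cder_cexp_0 : Cder cexp 0%C 1%C.
Proof.
apply Cder_spec; intros eps He.
(* The errors below add up to $e|u|+7e|v|\le8e|w|$. With $e\le1$ one has $|u|<1/2$, hence $e^u\le3$
   and $|e^u-1|\le2|u|$. *)
pose (e := Rmin (eps / 8) 1).
assert (He0 : 0 < e) by (unfold e; apply Rmin_pos; lra).
assert (He1 : e <= eps / 8) by apply Rmin_l.
assert (He2 : e <= 1) by apply Rmin_r.
destruct (derivable_0_bound exp 1 derivable_pt_lim_exp_0 e He0) as [d1 [Hd1 E1]].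
destruct (derivable_0_bound cos (- sin 0) (derivable_pt_lim_cos 0) e He0) as [d2 [Hd2 E2]].
destruct (derivable_0_bound sin (cos 0) (derivable_pt_lim_sin 0) e He0) as [d3 [Hd3 E3]].
rewrite exp_0 in E1; rewrite cos_0, sin_0 in E2; rewrite sin_0, cos_0 in E3.
(* [e / 2] makes $|e^u-1|\le2|u|\le e$, which controls the cross term $(e^u-1)v$. *)
exists (Rmin (Rmin d1 d2) (Rmin d3 (e / 2))); split.
{ repeat apply Rmin_pos; lra. }
intros [u v] Hw.
replace ((u, v) - 0)%C with (u, v) in Hw |- * by (unfold Cminus, Cplus; simpl; f_equal; ring).
assert (HM := Rmax_Cmod (u, v)); cbn [fst snd] in HM.
assert (Hu : Rabs u <= Cmod (u, v)) by (eapply Rle_trans; [apply Rmax_l | exact HM]).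
assert (Hv : Rabs v <= Cmod (u, v)) by (eapply Rle_trans; [apply Rmax_r | exact HM]).
assert (Hmin : Cmod (u, v) < d1 /\ Cmod (u, v) < d2 /\ Cmod (u, v) < d3 /\ Cmod (u, v) < e / 2).
{ revert Hw; unfold Rmin; repeat destruct Rle_dec; lra. }
destruct Hmin as (M1 & M2 & M3 & M4).
specialize (E1 u ltac:(lra)); specialize (E2 v ltac:(lra)); specialize (E3 v ltac:(lra)).
assert (Hexp : 0 < exp u <= 3).
{ split; [apply exp_pos|]. eapply Rle_trans; [|apply exp_le_3].
  apply Rlt_le, exp_increasing. generalize (Rle_abs u); lra. }
assert (Hexp1 : Rabs (exp u - 1) <= 2 * Rabs u).
{ replace (exp u - 1) with ((exp u - 1 - 1 * u) + u) by ring.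
  eapply Rle_trans; [apply Rabs_triang|]. generalize (Rabs_pos u); nra. }
unfold cexp, cis; cbn [fst snd].
match goal with |- Cmod ?x <= _ => replace x with (exp u * cos v - 1 - u, exp u * sin v - v) end.
2:{ unfold RtoC, Cminus, Copp, Cplus, Cmult; simpl. rewrite exp_0, cos_0, sin_0; f_equal; ring. }
eapply Rle_trans; [apply Cmod_le_abs|].
assert (A1 : Rabs (exp u * cos v - 1 - u) <= e * Rabs u + 3 * (e * Rabs v)).
{ replace (exp u * cos v - 1 - u) with ((exp u - 1 - 1 * u) + exp u * (cos v - 1 - - 0 * v)) by ring.
  eapply Rle_trans; [apply Rabs_triang|]. rewrite Rabs_mult, (Rabs_pos_eq (exp u)) by lra.
  generalize (Rabs_pos (cos v - 1 - - 0 * v)); nra. }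
assert (A2 : Rabs (exp u * sin v - v) <= 3 * (e * Rabs v) + e * Rabs v).
{ replace (exp u * sin v - v) with (exp u * (sin v - 0 - 1 * v) + (exp u - 1) * v) by ring.
  eapply Rle_trans; [apply Rabs_triang|]. rewrite !Rabs_mult, (Rabs_pos_eq (exp u)) by lra.
  apply Rplus_le_compat.
  - generalize (Rabs_pos (sin v - 0 - 1 * v)); nra.
  - apply Rmult_le_compat_r; [apply Rabs_pos | lra]. }
generalize (Rabs_pos u) (Rabs_pos v); nra.
Qed.

Lemma Cder_cexp z : Cder cexp z (cexp z).
Proof.
apply (Cder_ext (fun w => cexp z * cexp (w - z))%C).
{ intros w; rewrite <- cexp_plus; f_equal; ring. }
assert (H0 : Cder cexp (z - z)%C 1%C).
{ replace (z - z)%C with (RtoC 0) by ring; apply Cder_cexp_0. }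
assert (H := Cder_mult _ _ z _ _ (Cder_const (cexp z) z)
  (Cder_comp cexp (fun w => w - z)%C z _ _ H0 (Cder_minus _ _ z _ _ (Cder_id z) (Cder_const z z)))).
eapply Cder_val; [exact H | cbv beta; ring].
Qed.

Definition circle (a : C) (t : R) (th : R) : C := (a + RtoC t * cis th)%C.

Lemma Cmod_circle a t th : 0 <= t -> Cmod (circle a t th - a) = t.
Proof.
intros Ht; unfold circle; replace (a + t * cis th - a)%C with (t * cis th)%C by ring.
rewrite Cmod_mult, Cmod_cis, Cmod_R, Rabs_pos_eq; lra.
Qed.

Definition Cont (f : C -> C) (z : C) : Prop :=
  forall eps, 0 < eps -> exists d, 0 < d /\ forall w, Cmod (w - z) < d -> Cmod (f w - f z) < eps.

Lemma cis_Ccont t : Ccont cis t.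
Proof.
apply (Ccont_ext (fun s => cexp (0, s))).
- intros s; unfold cexp; simpl; rewrite exp_0; ring.
- eapply Cder_cont_v, Cder_cexp.
Qed.

Lemma Ccont_comp f h t : Cont f (h t) -> Ccont h t -> Ccont (fun s => f (h s)) t.
Proof.
intros Hf Hh; apply Ccont_spec; intros eps He.
destruct (Hf eps He) as [d [Hd Hd']].
destruct (proj1 (Ccont_spec _ _) Hh d Hd) as [e [He' He'']].
exists e; split; [exact He'|]; intros y Hy; apply Hd', He'', Hy.
Qed.

Lemma circle_Ccont a t th : Ccont (circle a t) th.
Proof.
apply (Ccont_comp (fun z => a + RtoC t * z)%C cis).
- intros eps He.
  assert (H := Cder_affine a t 0 (cis th)).
  destruct (Cder_cont _ _ _ H eps He) as [d [Hd Hd']].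
  exists d; split; [exact Hd|]; intros w Hw; specialize (Hd' w Hw).
  replace (a + t * w - (a + t * cis th))%C with (a + t * (w - 0) - (a + t * (cis th - 0)))%C by ring.
  exact Hd'.
- apply cis_Ccont.
Qed.

(** The horizontal sides of the rectangle cancel by periodicity, and the vertical ones are the two
    circles. As the exponential omits $0$, the centre is never met, which admits difference
    quotients at $a$. *)
Lemma mean_value_annulus k a R0 t0 t1 :
  holo_on k (fun z => 0 < Cmod (z - a) < R0) -> 0 < t0 <= t1 -> t1 < R0 ->
  CInt (fun th => k (circle a t1 th)) 0 (2 * PI) = CInt (fun th => k (circle a t0 th)) 0 (2 * PI).
Proof.
intros Hk Ht0 Ht1.
assert (HPI := PI_RGT_0).
assert (Hln : ln t0 <= ln t1) by (apply ln_le; lra).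
assert (Hh : holo_on (fun z => k (a + cexp z)%C) (rect (ln t0) (ln t1) 0 (2 * PI))).
{ intros z [Hz _].
  destruct (Hk (a + cexp z)%C) as [l Hl].
  - replace (a + cexp z - a)%C with (cexp z) by ring; rewrite Cmod_cexp.
    split; [apply exp_pos|]. apply Rle_lt_trans with t1; [|exact Ht1].
    rewrite <- (exp_ln t1) by lra. destruct (proj2 Hz) as [H|H].
    + apply Rlt_le, exp_increasing, H.
    + rewrite H; lra.
  - eexists. apply (Cder_comp k (fun w => a + cexp w)%C); [exact Hl|].
    apply Cder_plus; [apply Cder_const | apply Cder_cexp]. }
assert (HG := Goursat _ (ln t0) (ln t1) 0 (2 * PI) Hln ltac:(lra) Hh).
unfold rect_int in HG.
assert (Hper : forall x, cexp (x, 2 * PI) = cexp (x, 0)).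
{ intros x; unfold cexp, cis; simpl; rewrite sin_2PI, cos_2PI, sin_0, cos_0; reflexivity. }
rewrite (CInt_ext (fun x => k (a + cexp (x, (2 * PI)%R))%C) (fun x => k (a + cexp (x, 0))%C)) in HG
 by (intros; rewrite Hper; reflexivity).
assert (Hc : forall t, 0 < t -> CInt (fun y => k (a + cexp (ln t, y))%C) 0 (2 * PI) = CInt (fun th => k (circle a t th)) 0 (2 * PI)).
{ intros t Ht; apply CInt_ext; intros x _; unfold circle, cexp; simpl; rewrite exp_ln by exact Ht; reflexivity. }
rewrite (Hc t0), (Hc t1) in HG by lra.
match type of HG with (?x - ?x + Ci * (?u - ?v))%C = _ => 
  replace (x - x + Ci * (u - v))%C with (Ci * (u - v))%C in HG by ring;
  apply Ceq_minus; replace (u - v)%C with (- Ci * (Ci * (u - v)))%C; [rewrite HG; ring|];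
  replace (- Ci * (Ci * (u - v)))%C with ((- (Ci * Ci)) * (u - v))%C by ring end.
replace (- (Ci * Ci))%C with (RtoC 1); [ring|].
unfold RtoC, Ci, Cmult, Copp; simpl; f_equal; ring.
Qed.

(** The circle mean does not depend on the radius, and for small radii continuity at $a$ puts it
    close to $k(a)$. *)
Lemma mean_value k a R0 t :
  holo_on k (fun z => 0 < Cmod (z - a) < R0) -> Cont k a -> 0 < t < R0 ->
  CInt (fun th => k (circle a t th)) 0 (2 * PI) = (RtoC (2 * PI) * k a)%C.
Proof.
intros Hk Ha Ht.
assert (HPI := PI_RGT_0).
apply Ceq_minus, Cmod_eq_0, Rle_antisym; [|apply Cmod_ge_0].
apply le_epsilon; intros eps He; rewrite Rplus_0_l.
destruct (Ha (eps / (2 * PI))) as [d [Hd Hd']]; [apply Rdiv_lt_0_compat; lra|].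
pose (t0 := Rmin (d / 2) t).
assert (Ht0 : 0 < t0) by (unfold t0; apply Rmin_pos; lra).
assert (Ht0d : t0 <= d / 2) by apply Rmin_l.
assert (Ht0t : t0 <= t) by apply Rmin_r.
assert (Hc : Ccont_on (fun th => k (circle a t0 th)) 0 (2 * PI)).
{ intros x _; apply (Ccont_comp k (circle a t0)); [|apply circle_Ccont].
  intros e He'. destruct (Hk (circle a t0 x)) as [l Hl].
  - rewrite Cmod_circle; lra.
  - exact (Cder_cont _ _ _ Hl e He'). }
rewrite (mean_value_annulus k a R0 t0 t) by (try assumption; lra).
assert (E := CInt_minus (fun th => k (circle a t0 th)) (fun _ => k a) 0 (2 * PI) Hc).
rewrite CInt_const, Rminus_0_r in E.
rewrite <- E.
- eapply Rle_trans; [apply (CInt_bound _ _ _ (eps / (2 * PI)))|].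
  + lra.
  + intros x Hx; apply Ccont_spec; intros e He'.
    destruct (proj1 (Ccont_spec _ _) (Hc x Hx) e He') as [d' [H1 H2]].
    exists d'; split; [exact H1|]; intros y Hy; specialize (H2 y Hy).
    replace (k (circle a t0 y) - k a - (k (circle a t0 x) - k a))%C with (k (circle a t0 y) - k (circle a t0 x))%C by ring.
    exact H2.
  + intros x _; apply Rlt_le, Hd'; rewrite Cmod_circle; lra.
  + right; field; lra.
- intros x _; apply Ccont_spec; intros e He'; exists 1; split; [lra|]; intros y _.
  unfold Cminus; rewrite Cplus_opp_r, Cmod_0; exact He'.
Qed.

(** * Compactness in the plane *)

Lemma Copen_spec U : Copen U <-> forall z, U z -> exists d, 0 < d /\ forall w, Cmod (w - z) < d -> U w.
Proof.
split.
- intros H z Hz; destruct (proj1 (locally_C z U) (H z Hz)) as [d Hd].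
  exists d; split; [apply cond_pos | exact Hd].
- intros H z Hz; apply locally_C; destruct (H z Hz) as [d [Hd Hd']].
  exists (mkposreal d Hd); exact Hd'.
Qed.

Lemma Copen_disc c s : Copen (fun z => Cmod (z - c) < s).
Proof.
apply Copen_spec; intros z Hz; exists (s - Cmod (z - c)); split; [lra|]; intros w Hw.
replace (w - c)%C with ((w - z) + (z - c))%C by ring.
eapply Rle_lt_trans; [apply Cmod_triangle | lra].
Qed.

(** A small rectangle about a point lies in a single member of the cover, and the finite covers of
    four quarters are concatenated. *)
Lemma Ccompact_rect a b c d : a <= b -> c <= d -> Ccompact (rect a b c d).
Proof.
intros Hab Hcd I U HU Hcov.
apply (rect_induction (fun a b c d => exists l, forall z, rect a b c d z -> exists i, In i l /\ U i z)); try assumption.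
- intros a' b' c' d' _ _ _ _ [l1 H1] [l2 H2] [l3 H3] [l4 H4].
  exists (l1 ++ l2 ++ l3 ++ l4); intros z [Hx Hy].
  destruct (Rle_dec (fst z) ((a' + b') / 2)), (Rle_dec (snd z) ((c' + d') / 2));
  [destruct (H1 z) as [i [Hi Ui]] | destruct (H2 z) as [i [Hi Ui]] | destruct (H3 z) as [i [Hi Ui]] | destruct (H4 z) as [i [Hi Ui]]];
  try (split; lra); exists i; (split; [|exact Ui]); rewrite !in_app_iff; tauto.
- intros p q Hp Hq.
  destruct (Hcov (p, q)) as [i Hi]; [split; assumption|].
  destruct (proj1 (Copen_spec _) (HU i) _ Hi) as [e [He He']].
  exists (e / 2); split; [lra|].
  intros a' b' c' d' H1 H2 H3 H4 H5 H6; exists (i :: nil).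
  intros [x y] [Hx Hy]; simpl in Hx, Hy; exists i; split; [left; reflexivity|].
  apply He'. eapply Rle_lt_trans; [apply (Cmod_le_abs (x + - p) (y + - q))|].
  apply Rlt_le_trans with (e / 2 + e / 2); [|lra].
  apply Rplus_lt_compat; apply Rabs_def1; lra.
Qed.

Lemma Ccompact_closed (K F : C -> Prop) : Ccompact K -> (forall z, F z -> K z) ->
  Copen (fun z => ~ F z) -> Ccompact F.
Proof.
intros HK HFK HF I U HU Hcov.
(* The complement of $F$ joins the cover under the index [None]. *)
destruct (HK (option I) (fun o => match o with Some i => U i | None => fun z => ~ F z end)) as [l Hl].
- intros [i|]; [apply HU | exact HF].
- intros z Hz; destruct (classic (F z)) as [H|H].
  + destruct (Hcov z H) as [i Hi]; exists (Some i); exact Hi.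
  + exists None; exact H.
- exists (flat_map (fun o => match o with Some i => i :: nil | None => nil end) l).
  intros z Hz; destruct (Hl z (HFK z Hz)) as [[i|] [Hi Ui]].
  + exists i; split; [|exact Ui]. apply in_flat_map; exists (Some i); split; [exact Hi | left; reflexivity].
  + contradiction.
Qed.

Lemma Cmod_fst_snd z : Rabs (fst z) <= Cmod z /\ Rabs (snd z) <= Cmod z.
Proof.
assert (H := Rmax_Cmod z); split; (eapply Rle_trans; [|exact H]); [apply Rmax_l | apply Rmax_r].
Qed.

(** For [d = 0] this is the closed disc; proper annuli serve the maximum principle. *)
Lemma Ccompact_annulus c d s : Ccompact (fun z => d <= Cmod (z - c) <= s).
Proof.
destruct (Rle_dec 0 s) as [Hs|Hs].
2:{ intros I U _ _; exists nil; intros z Hz; exfalso; generalize (Cmod_ge_0 (z - c)); lra. }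
apply (Ccompact_closed (rect (fst c - s) (fst c + s) (snd c - s) (snd c + s))).
- apply Ccompact_rect; lra.
- intros z Hz. destruct (Cmod_fst_snd (z - c)%C) as [H1 H2].
  change (fst (z - c)%C) with (fst z + - fst c) in H1; change (snd (z - c)%C) with (snd z + - snd c) in H2.
  apply Rabs_le_between in H1; apply Rabs_le_between in H2; split; lra.
- apply Copen_spec; intros z Hz.
  assert (Hz' : Cmod (z - c) < d \/ s < Cmod (z - c)) by lra.
  assert (T : forall w, Cmod (w - c) <= Cmod (w - z) + Cmod (z - c) /\ Cmod (z - c) <= Cmod (w - z) + Cmod (w - c)).
  { intros w; split.
    - replace (w - c)%C with ((w - z) + (z - c))%C by ring; apply Cmod_triangle.
    - replace (z - c)%C with (- (w - z) + (w - c))%C by ring. rewrite <- (Cmod_opp (w - z)); apply Cmod_triangle. }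
  destruct Hz' as [H|H].
  + exists (d - Cmod (z - c)); split; [lra|]; intros w Hw; specialize (T w); lra.
  + exists (Cmod (z - c) - s); split; [lra|]; intros w Hw; specialize (T w); lra.
Qed.

Definition Rcont (h : C -> R) (z : C) : Prop :=
  forall eps, 0 < eps -> exists d, 0 < d /\ forall w, Cmod (w - z) < d -> Rabs (h w - h z) < eps.

Lemma compact_max K h : Ccompact K -> (exists z, K z) -> (forall z, K z -> Rcont h z) ->
  exists m, K m /\ forall z, K z -> h z <= h m.
Proof.
intros HK [z0 Hz0] Hc; apply NNPP; intros Hno.
(* Without a maximum these sets cover $K$. The interior of $\{h<h(z')\}$ is used, because $h$ is
   continuous only at the points of $K$; the largest value among finitely many $z'$ gives the
   contradiction. *)
destruct (HK C (fun z' w => K z' /\ exists d, 0 < d /\ forall v, Cmod (v - w) < d -> h v < h z')) as [l Hl].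
- intros z'; apply Copen_spec; intros w [Hz' [d [Hd Hd']]].
  exists (d / 2); split; [lra|]; intros v Hv; split; [exact Hz'|].
  exists (d / 2); split; [lra|]; intros x Hx; apply Hd'.
  replace (x - w)%C with ((x - v) + (v - w))%C by ring.
  eapply Rle_lt_trans; [apply Cmod_triangle | lra].
- intros z Hz.
  apply NNPP; intros Hn; apply Hno; exists z; split; [exact Hz|]; intros z' Hz'.
  apply Rnot_lt_le; intros Hlt; apply Hn; exists z'; split; [exact Hz'|].
  destruct (Hc z Hz (h z' - h z)) as [d [Hd Hd']]; [lra|].
  exists d; split; [exact Hd|]; intros v Hv; specialize (Hd' v Hv).
  apply Rabs_def2 in Hd'; lra.
- assert (Hm : forall l, exists m, K m /\ forall z, In z l -> K z -> h z <= h m).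
  { induction l0 as [|x l0 [m [Km Hm]]].
    - exists z0; split; [exact Hz0|]; intros z [].
    - destruct (classic (K x /\ h m < h x)) as [[H1 H2]|H].
      + exists x; split; [exact H1|]; intros z [<-|Hz] Kz; [lra|]. specialize (Hm z Hz Kz); lra.
      + exists m; split; [exact Km|]; intros z [<-|Hz] Kz; [|apply Hm; assumption].
        apply Rnot_lt_le; intros Hlt; apply H; split; assumption. }
  destruct (Hm l) as [m [Km Hm']].
  destruct (Hl m Km) as [z' [Hz' [Kz' [d [Hd Hd']]]]].
  specialize (Hm' z' Hz' Kz'). specialize (Hd' m).
  unfold Cminus in Hd'; rewrite Cplus_opp_r, Cmod_0 in Hd'. specialize (Hd' Hd); lra.
Qed.

Lemma Cmod_rev_triangle z w : Rabs (Cmod z - Cmod w) <= Cmod (z - w).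
Proof.
apply Rabs_le; split.
- assert (H := Cmod_triangle z (- (z - w))). rewrite Cmod_opp in H.
  replace (z + - (z - w))%C with w in H by ring; lra.
- assert (H := Cmod_triangle (z - w) w).
  replace (z - w + w)%C with z in H by ring; lra.
Qed.

Lemma Cont_Cmod f z : Cont f z -> Rcont (fun w => Cmod (f w)) z.
Proof.
intros H eps He; destruct (H eps He) as [d [Hd Hd']]; exists d; split; [exact Hd|]; intros w Hw.
eapply Rle_lt_trans; [apply Cmod_rev_triangle | apply Hd', Hw].
Qed.

Lemma Cder_Cont f z l : Cder f z l -> Cont f z.
Proof. intros H eps He; exact (Cder_cont f z l H eps He). Qed.

Lemma compact_bound K f : Ccompact K -> (forall z, K z -> Cont f z) ->
  exists M, 0 < M /\ forall z, K z -> Cmod (f z) <= M.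
Proof.
intros HK Hf; destruct (classic (exists z, K z)) as [Hn|Hn].
- destruct (compact_max K (fun w => Cmod (f w)) HK Hn) as [m [Km Hm]].
  + intros z Hz; apply Cont_Cmod, Hf, Hz.
  + exists (Cmod (f m) + 1); split; [generalize (Cmod_ge_0 (f m)); lra|].
    intros z Hz; specialize (Hm z Hz); lra.
- exists 1; split; [lra|]; intros z Hz; exfalso; apply Hn; exists z; exact Hz.
Qed.

Lemma disc_bound c s f : (forall z, Cmod (z - c) <= s -> Cont f z) ->
  exists M, 0 < M /\ forall z, Cmod (z - c) <= s -> Cmod (f z) <= M.
Proof.
intros Hf; destruct (compact_bound _ f (Ccompact_annulus c 0 s)) as [M [HM HM']].
- intros z [_ Hz]; apply Hf, Hz.
- exists M; split; [exact HM|]; intros z Hz; apply HM'; split; [apply Cmod_ge_0 | exact Hz].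
Qed.

(** * The derivative of an entire function is entire *)

Lemma Re_line F z0 h (t : R) l : Cder F (z0 + t * h)%C l ->
  is_derive (fun s : R => Re (F (z0 + s * h)%C)) t (Re (l * h)).
Proof.
intros H; destruct (Cder_line _ _ _ _ _ H) as [_ HD].
split; [apply is_linear_scal_l|]. intros x Hx eps.
generalize (HD x Hx eps); apply filter_imp; intros s Hs.
eapply Rle_trans; [|exact Hs]. rewrite Cmod_norm_R.
eapply Rle_trans; [|apply re_le_Cmod]. right. reflexivity.
Qed.

Lemma Im_line F z0 h (t : R) l : Cder F (z0 + t * h)%C l ->
  is_derive (fun s : R => Im (F (z0 + s * h)%C)) t (Im (l * h)).
Proof.
intros H; destruct (Cder_line _ _ _ _ _ H) as [_ HD].
split; [apply is_linear_scal_l|]. intros x Hx eps.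
generalize (HD x Hx eps); apply filter_imp; intros s Hs.
eapply Rle_trans; [|exact Hs]. rewrite Cmod_norm_R.
eapply Rle_trans; [|apply Cmod_fst_snd]. right. reflexivity.
Qed.

Lemma MVT_01 (phi dphi : R -> R) : (forall s, 0 <= s <= 1 -> is_derive phi s (dphi s)) ->
  exists s, 0 <= s <= 1 /\ phi 1 - phi 0 = dphi s.
Proof.
intros H; destruct (MVT_gen phi 0 1 dphi) as [s [Hs E]].
- rewrite Rmin_left, Rmax_right by lra; intros x Hx; apply H; lra.
- rewrite Rmin_left, Rmax_right by lra; intros x Hx; apply continuity_pt_filterlim.
  apply (ex_derive_continuous phi x); exists (dphi x); apply H, Hx.
- rewrite Rmin_left, Rmax_right in Hs by lra; exists s; split; [exact Hs | lra].
Qed.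

Lemma disc_convex (a z w : C) rho (s : R) : Cmod (z - a) <= rho -> Cmod (w - a) <= rho -> 0 <= s <= 1 ->
  Cmod (z + s * (w - z) - a) <= rho.
Proof.
intros Hz Hw Hs.
replace (z + s * (w - z) - a)%C with (RtoC (1 - s) * (z - a) + s * (w - a))%C by (rewrite RtoC_minus; ring).
eapply Rle_trans; [apply Cmod_triangle|]. rewrite !Cmod_mult, !Cmod_R, !Rabs_pos_eq by lra. nra.
Qed.

(** The real mean value theorem is applied on the segment to $\mathrm{Re}(\overline D(f(u)-cu))$,
    where $D$ is the very difference to be bounded; this yields $|D|^2\le|D|L|w-z|$. *)
Lemma mean_value_ineq f df c a rho L z w :
  (forall u, Cmod (u - a) <= rho -> Cder f u (df u) /\ Cmod (df u - c) <= L) ->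
  Cmod (z - a) <= rho -> Cmod (w - a) <= rho ->
  Cmod (f w - f z - c * (w - z)) <= L * Cmod (w - z).
Proof.
intros H Hz Hw.
set (D := (f w - f z - c * (w - z))%C).
destruct (Req_dec (Cmod D) 0) as [E|Hn].
{ rewrite E; apply Rmult_le_pos; [|apply Cmod_ge_0].
  eapply Rle_trans; [apply Cmod_ge_0 | apply (H z Hz)]. }
assert (HD : 0 < Cmod D) by (generalize (Cmod_ge_0 D); lra).
pose (F := fun u => (Cconj D * (f u - c * u))%C).
assert (HF : forall s : R, 0 <= s <= 1 -> Cder F (z + s * (w - z))%C (Cconj D * (df (z + s * (w - z)) - c))%C).
{ intros s Hs; destruct (H _ (disc_convex a z w rho s Hz Hw Hs)) as [H1 _].
  assert (X := Cder_mult _ _ _ _ _ (Cder_const (Cconj D) _)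
    (Cder_minus _ _ _ _ _ H1 (Cder_mult _ _ _ _ _ (Cder_const c _) (Cder_id _)))).
  eapply Cder_val; [exact X | cbv beta; ring]. }
destruct (MVT_01 (fun s => Re (F (z + s * (w - z))%C)) (fun s => Re (Cconj D * (df (z + s * (w - z))%C - c) * (w - z))%C)) as [s [Hs E]].
{ intros s Hs; apply Re_line, HF, Hs. }
destruct (H _ (disc_convex a z w rho s Hz Hw Hs)) as [_ H2].
assert (E1 : Cmod D ^ 2 = Re (Cconj D * (df (z + s * (w - z))%C - c) * (w - z))%C).
{ rewrite <- E. apply RtoC_inj. rewrite Cmod2_conj. 
  assert (E2 : (D * Cconj D)%C = (F (z + 1%R * (w - z)) - F (z + 0%R * (w - z)))%C).
  { unfold F, D; replace (z + 1%R * (w - z))%C with w by ring; replace (z + 0%R * (w - z))%C with z by ring. ring. }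
  assert (E3 : Re (D * Cconj D)%C = Re (F (z + 1%R * (w - z))%C) - Re (F (z + 0%R * (w - z))%C)).
  { rewrite E2. unfold Cminus at 1. rewrite re_plus, re_opp; reflexivity. }
  rewrite <- E3, <- Cmod2_conj, re_RtoC; reflexivity. }
assert (E4 := re_le_Cmod (Cconj D * (df (z + s * (w - z))%C - c) * (w - z))%C).
rewrite !Cmod_mult, Cmod_conj, <- E1 in E4.
rewrite Rabs_pos_eq in E4 by (apply pow2_ge_0).
apply Rmult_le_reg_l with (Cmod D); [exact HD|].
eapply Rle_trans; [right|eapply Rle_trans; [exact E4|]]; [ring|].
rewrite Rmult_assoc; apply Rmult_le_compat_l; [lra|].
apply Rmult_le_compat_r; [apply Cmod_ge_0 | exact H2].
Qed.

(* [circ_der F a / (2 pi)] is the derivative at [a] of an entire [F]. *)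
Definition circ_der (F : C -> C) (a : C) : C :=
  CInt (fun th => (/ cis th * (F (circle a 1 th) - F a))%C) 0 (2 * PI).

(** The mean value property of the difference quotient at $a$, completed by [df a], which makes it
    continuous there. On the unit circle its denominator is [cis th]. *)
Lemma circ_der_entire f df a : (forall z, Cder f z (df z)) -> (RtoC (2 * PI) * df a)%C = circ_der f a.
Proof.
intros Hf.
pose (k := fun z => if Ceq_dec z a then df a else ((f z - f a) / (z - a))%C).
assert (Hne : forall z, z <> a -> (z - a)%C <> 0%C).
{ intros z Hz E; apply Hz, Ceq_minus, E. }
assert (ka : k a = df a) by (unfold k; destruct Ceq_dec; congruence).
assert (kz : forall z, z <> a -> k z = ((f z - f a) / (z - a))%C).
{ intros z Hz; unfold k; destruct Ceq_dec; congruence. }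
assert (Hk : holo_on k (fun z => 0 < Cmod (z - a) < 2)).
{ intros z [Hz _].
  eexists. apply (Cder_ext_loc (fun w => (f w - f a) / (w - a))%C _ _ _ _ Hz).
  - intros w Hw. symmetry; apply kz; intros ->.
    replace (a - z)%C with (- (z - a))%C in Hw by ring. rewrite Cmod_opp in Hw; lra.
  - apply (Cder_div (fun w => f w - f a)%C (fun w => w - a)%C).
    + apply Cmod_gt_0, Hz.
    + apply Cder_minus; [apply Hf | apply Cder_const].
    + apply Cder_minus; [apply Cder_id | apply Cder_const]. }
assert (Hc : Cont k a).
{ intros eps He. destruct (proj1 (Cder_spec _ _ _) (Hf a) (eps / 2)) as [d [Hd Hd']]; [lra|].
  exists d; split; [exact Hd|]; intros w Hw; rewrite ka.
  destruct (Ceq_dec w a) as [->|Hn].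
  - rewrite ka; unfold Cminus; rewrite Cplus_opp_r, Cmod_0; exact He.
  - rewrite kz by exact Hn. specialize (Hd' w Hw). specialize (Hne w Hn).
    replace ((f w - f a) / (w - a) - df a)%C with ((f w - f a - df a * (w - a)) / (w - a))%C by (field; exact Hne).
    rewrite Cmod_div by exact Hne.
    apply Cmod_gt_0 in Hne.
    apply Rle_lt_trans with (eps / 2); [|lra]. apply Rle_div_l; assumption. }
rewrite <- ka, <- (mean_value k a 2 1 Hk Hc) by lra.
apply CInt_ext; intros th _.
assert (E : (circle a 1 th - a)%C = cis th) by (unfold circle; ring).
rewrite kz.
- rewrite E; unfold Cdiv; ring.
- intros E'; rewrite E' in E. apply (cis_nz th). rewrite <- E; ring.
Qed.

Lemma Ccont_mult h k t : Ccont h t -> Ccont k t -> Ccont (fun s => h s * k s)%C t.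
Proof.
intros Hh Hk; apply Ccont_spec; intros eps He.
set (M := 1 + Cmod (h t) + Cmod (k t)).
assert (HM : 1 <= M) by (unfold M; generalize (Cmod_ge_0 (h t)) (Cmod_ge_0 (k t)); lra).
pose (e := Rmin 1 (eps / (3 * M))).
assert (He0 : 0 < e) by (unfold e; apply Rmin_pos; [lra | apply Rdiv_lt_0_compat; lra]).
assert (He1 : e <= 1) by apply Rmin_l.
assert (He2 : e * (3 * M) <= eps) by (apply Rle_div_r; [lra | apply Rmin_r]).
destruct (proj1 (Ccont_spec _ _) Hh e He0) as [d1 [Hd1 H1]].
destruct (proj1 (Ccont_spec _ _) Hk e He0) as [d2 [Hd2 H2]].
exists (Rmin d1 d2); split; [apply Rmin_pos; assumption|]; intros y Hy.
specialize (H1 y (Rlt_le_trans _ _ _ Hy (Rmin_l _ _))).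
specialize (H2 y (Rlt_le_trans _ _ _ Hy (Rmin_r _ _))).
replace (h y * k y - h t * k t)%C with ((h y - h t) * (k y - k t) + (h y - h t) * k t + h t * (k y - k t))%C by ring.
eapply Rle_lt_trans; [apply Cmod_triangle|].
eapply Rle_lt_trans; [apply Rplus_le_compat_r, Cmod_triangle|].
rewrite !Cmod_mult. unfold M in *.
generalize (Cmod_ge_0 (h y - h t)) (Cmod_ge_0 (k y - k t)) (Cmod_ge_0 (h t)) (Cmod_ge_0 (k t)); nra.
Qed.

Lemma Cont_minus f g z : Cont f z -> Cont g z -> Cont (fun w => f w - g w)%C z.
Proof.
intros Hf Hg eps He.
destruct (Hf (eps / 2)) as [d1 [Hd1 H1]]; [lra|].
destruct (Hg (eps / 2)) as [d2 [Hd2 H2]]; [lra|].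
exists (Rmin d1 d2); split; [apply Rmin_pos; assumption|]; intros y Hy.
specialize (H1 y (Rlt_le_trans _ _ _ Hy (Rmin_l _ _))).
specialize (H2 y (Rlt_le_trans _ _ _ Hy (Rmin_r _ _))).
replace (f y - g y - (f z - g z))%C with ((f y - f z) + - (g y - g z))%C by ring.
eapply Rle_lt_trans; [apply Cmod_triangle|]. rewrite Cmod_opp; lra.
Qed.

Lemma Cont_scal c f z : Cont f z -> Cont (fun w => c * f w)%C z.
Proof.
intros Hf eps He.
assert (Hc : 0 < 1 + Cmod c) by (generalize (Cmod_ge_0 c); lra).
destruct (Hf (eps / (1 + Cmod c))) as [d1 [Hd1 H1]]; [apply Rdiv_lt_0_compat; lra|].
exists d1; split; [exact Hd1|]; intros y Hy; specialize (H1 y Hy).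
replace (c * f y - c * f z)%C with (c * (f y - f z))%C by ring.
rewrite Cmod_mult; apply Rlt_div_r in H1; [|lra].
generalize (Cmod_ge_0 (f y - f z)); nra.
Qed.

Lemma Cont_shift f h z : Cont f (z + h)%C -> Cont (fun w => f (w + h)%C) z.
Proof.
intros Hf eps He; destruct (Hf eps He) as [d [Hd H]]; exists d; split; [exact Hd|].
intros w Hw; apply H. replace (w + h - (z + h))%C with (w - z)%C by ring; exact Hw.
Qed.

Lemma Cont_const c z : Cont (fun _ => c) z.
Proof. exact (Cder_Cont _ _ _ (Cder_const c z)). Qed.

Lemma circ_der_cont F a : (forall z, Cont F z) ->
  Ccont_on (fun th => (/ cis th * (F (circle a 1 th) - F a))%C) 0 (2 * PI).
Proof.
intros HF th _.
apply (Ccont_mult (fun th => / cis th)%C).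
- apply (Ccont_comp Cinv cis); [|apply cis_Ccont].
  exact (Cder_Cont _ _ _ (Cder_inv _ (cis_nz th))).
- apply (Ccont_comp (fun z => F z - F a)%C (circle a 1)); [|apply circle_Ccont].
  apply Cont_minus; [apply HF | apply Cont_const].
Qed.

Lemma circ_der_minus F G a : (forall z, Cont F z) -> (forall z, Cont G z) ->
  circ_der (fun z => F z - G z)%C a = (circ_der F a - circ_der G a)%C.
Proof.
intros HF HG; unfold circ_der; rewrite <- CInt_minus by (apply circ_der_cont; assumption).
apply CInt_ext; intros th _; ring.
Qed.

Lemma circ_der_scal c F a : (forall z, Cont F z) ->
  circ_der (fun z => c * F z)%C a = (c * circ_der F a)%C.
Proof.
intros HF; unfold circ_der; rewrite <- CInt_scal by (apply circ_der_cont; assumption).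
apply CInt_ext; intros th _; ring.
Qed.

Lemma circ_der_shift F a h : circ_der (fun z => F (z + h)%C) a = circ_der F (a + h)%C.
Proof.
apply CInt_ext; intros th _; unfold circle; replace (a + 1 * cis th + h)%C with (a + h + 1 * cis th)%C by ring; reflexivity.
Qed.

Lemma circ_der_bound F a M : (forall z, Cont F z) -> (forall z, Cmod (z - a) <= 1 -> Cmod (F z) <= M) ->
  Cmod (circ_der F a) <= 2 * PI * (2 * M).
Proof.
intros HF HM; rewrite <- (Rminus_0_r (2 * PI)) at 1.
apply CInt_bound; [generalize PI_RGT_0; lra | apply circ_der_cont, HF|].
intros th _; rewrite Cmod_mult, Cmod_inv by apply cis_nz. rewrite Cmod_cis, Rinv_1, Rmult_1_l.
unfold Cminus; eapply Rle_trans; [apply Cmod_triangle|]; rewrite Cmod_opp.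
assert (H1 := HM (circle a 1 th)); rewrite Cmod_circle in H1 by lra.
assert (H2 := HM a). unfold Cminus in H2; rewrite Cplus_opp_r, Cmod_0 in H2. lra.
Qed.

(** [circ_der] is linear, commutes with translations and is bounded by the supremum on a unit disc,
    so estimates for $f$ turn into estimates for $f'$: a Lipschitz bound for $f$ gives one for $f'$,
    and then $f(b+h)-f(b)-hf'(b)=O(h^2)$ gives the differentiability of $f'$. *)
Lemma derivative_holomorphic f df : (forall z, Cder f z (df z)) -> forall z, exists l, Cder df z l.
Proof.
intros Hf a.
assert (HPI := PI_RGT_0).
assert (Hfc : forall z, Cont f z) by (intros z; exact (Cder_Cont _ _ _ (Hf z))).
assert (HT : forall b z w, Cmod (z - w) <= Cmod (z - b) + Cmod (w - b)).
{ intros b z w; replace (z - w)%C with ((z - b) + - (w - b))%C by ring.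
  rewrite <- (Cmod_opp (w - b)); apply Cmod_triangle. }
assert (HT2 : forall b z w, Cmod (z - b) <= Cmod (z - w) + Cmod (w - b)).
{ intros b z w; replace (z - b)%C with ((z - w) + (w - b))%C by ring; apply Cmod_triangle. }
assert (Hdiv : forall u M, Cmod (RtoC (2 * PI) * u) <= 2 * PI * M -> Cmod u <= M).
{ intros u M H; rewrite Cmod_mult, Cmod_R, Rabs_pos_eq in H by lra.
  apply Rmult_le_reg_l with (2 * PI); lra. }
assert (Hloc : forall b, exists L, 0 < L /\ forall z w, Cmod (z - b) <= 3 -> Cmod (w - b) <= 3 -> Cmod (df w - df z) <= L * Cmod (w - z)).
{ clear a; intros a.
  (* For $z,w$ within 3 of the centre and $b$ within 1 of $z$, the points $b$ and $b+(w-z)$ are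
     within 10, and unit discs about points within 10 stay within 20. *)
  destruct (disc_bound a 20 f (fun z _ => Hfc z)) as [M [HM HfM]].
  assert (H1 : forall b, Cmod (b - a) <= 10 -> Cmod (df b) <= 2 * M).
  { intros b Hb; apply Hdiv; rewrite (circ_der_entire f df b Hf).
    apply circ_der_bound; [exact Hfc|]; intros z Hz; apply HfM; specialize (HT2 a z b); lra. }
  assert (H2 : forall z w, Cmod (z - a) <= 10 -> Cmod (w - a) <= 10 -> Cmod (f w - f z) <= 2 * M * Cmod (w - z)).
  { intros z w Hz Hw; replace (f w - f z)%C with (f w - f z - 0 * (w - z))%C by ring.
    apply (mean_value_ineq f df 0%C a 10); try assumption.
    intros u Hu; split; [apply Hf|]. replace (df u - 0)%C with (df u) by ring; apply H1, Hu. }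
  exists (2 * (2 * M)); split; [lra|]; intros z w Hz Hw.
  apply Hdiv.
  replace (RtoC (2 * PI) * (df w - df z))%C with (RtoC (2 * PI) * df w - RtoC (2 * PI) * df z)%C by ring.
  rewrite !(circ_der_entire f df _ Hf).
  replace w with (z + (w - z))%C at 1 by ring.
  rewrite <- circ_der_shift, <- circ_der_minus; [|intros; apply Cont_shift, Hfc | exact Hfc].
  rewrite (Rmult_assoc 2 (2 * M)); apply circ_der_bound.
  - intros u; apply Cont_minus; [apply Cont_shift|]; apply Hfc.
  - intros b Hb.
    replace (Cmod (w - z)) with (Cmod (b + (w - z) - b)) by (f_equal; ring).
    assert (Hba := HT2 a b z).
    apply H2; [lra|]. specialize (HT2 a (b + (w - z))%C b).
    replace (b + (w - z) - b)%C with (w - z)%C in HT2 by ring.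
    specialize (HT a w z). lra. }
assert (Hdfc : forall z, Cont df z).
{ intros z eps He; destruct (Hloc z) as [L [HL H]].
  exists (Rmin 1 (eps / L)); split; [apply Rmin_pos; [lra | apply Rdiv_lt_0_compat; assumption]|].
  intros w Hw.
  assert (W1 := Rlt_le_trans _ _ _ Hw (Rmin_l _ _)).
  assert (W2 := Rlt_le_trans _ _ _ Hw (Rmin_r _ _)).
  apply Rlt_div_r in W2; [|exact HL].
  eapply Rle_lt_trans; [apply H|lra]; [|lra]. unfold Cminus; rewrite Cplus_opp_r, Cmod_0; lra. }
destruct (Hloc a) as [L [HL H]].
exists (/ RtoC (2 * PI) * circ_der df a)%C.
assert (H2pi : RtoC (2 * PI) <> 0%C) by (intros E; apply RtoC_inj in E; lra).
apply Cder_spec; intros eps He.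
exists (Rmin 1 (eps / (2 * L))); split; [apply Rmin_pos; [lra | apply Rdiv_lt_0_compat; lra]|].
intros w Hw.
assert (W1 := Rlt_le_trans _ _ _ Hw (Rmin_l _ _)).
assert (W2 := Rlt_le_trans _ _ _ Hw (Rmin_r _ _)).
apply Rlt_div_r in W2; [|lra].
set (h := (w - a)%C) in *.
assert (Hpos := Cmod_ge_0 h).
apply Rle_trans with (2 * (L * Cmod h * Cmod h)); [|nra].
apply Hdiv.
(* After this rewriting the error is [circ_der] at $a$ of $b\mapsto f(b+h)-f(b)-hf'(b)$. *)
replace (RtoC (2 * PI) * (df w - df a - / RtoC (2 * PI) * circ_der df a * h))%C with
  (RtoC (2 * PI) * df w - RtoC (2 * PI) * df a - h * circ_der df a)%C by (field; exact H2pi).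
rewrite !(circ_der_entire f df _ Hf).
replace w with (a + h)%C by (unfold h; ring).
rewrite <- circ_der_shift, <- circ_der_scal, <- !circ_der_minus;
 try (intros; repeat first [apply Cont_minus | apply Cont_scal | apply Cont_shift | apply Hfc | apply Hdfc]).
apply circ_der_bound.
- intros; repeat first [apply Cont_minus | apply Cont_scal | apply Cont_shift | apply Hfc | apply Hdfc].
- intros b Hb.
  replace (f (b + h)%C - f b - h * df b)%C with (f (b + h)%C - f b - df b * ((b + h) - b))%C by ring.
  replace (Cmod h) with (Cmod ((b + h) - b)) at 2 by (f_equal; ring).
  apply (mean_value_ineq f df (df b) b (Cmod h)).
  + intros u Hu; split; [apply Hf|].
    eapply Rle_trans; [apply H|apply Rmult_le_compat_l; lra]; [lra|].
    specialize (HT2 a u b); lra.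
  + unfold Cminus; rewrite Cplus_opp_r, Cmod_0; exact Hpos.
  + right; f_equal; ring.
Qed.

(** * Logarithms of zero-free functions *)

(** A square rather than a disc, since with two points it contains the whole axis-parallel rectangle
    that they span. *)
Definition square (c : C) (s : R) (z : C) : Prop :=
  Rabs (fst z - fst c) < s /\ Rabs (snd z - snd c) < s.

Lemma CInt_bound_abs h a b M : Ccont_on h a b ->
  (forall x, Rmin a b <= x <= Rmax a b -> Cmod (h x) <= M) -> Cmod (CInt h a b) <= Rabs (b - a) * M.
Proof.
intros Hc HM; destruct (Rle_dec a b) as [H|H].
- rewrite Rmin_left, Rmax_right in HM by lra. rewrite Rabs_pos_eq by lra.
  apply CInt_bound; assumption.
- assert (Hc' : Ccont_on h b a) by (intros x; rewrite Rmin_comm, Rmax_comm; apply Hc).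
  rewrite (CInt_swap h b a Hc'), Cmod_opp.
  rewrite Rmin_right, Rmax_left in HM by lra. rewrite Rabs_left by lra.
  rewrite Ropp_minus_distr. apply CInt_bound; [lra | assumption | assumption].
Qed.

Lemma CInt_point h a : CInt h a a = 0%C.
Proof. apply (RInt_point (V := C_R_CompleteNormedModule)). Qed.

Section Square.
Variables (c : C) (s : R) (q : C -> C).
Hypothesis Hq : holo_on q (square c s).

Lemma interval_between u a b t : Rabs (a - u) < s -> Rabs (b - u) < s ->
  Rmin a b <= t <= Rmax a b -> Rabs (t - u) < s.
Proof.
intros Ha Hb Ht; apply Rabs_def2 in Ha; apply Rabs_def2 in Hb; apply Rabs_def1;
revert Ht; unfold Rmin, Rmax; destruct Rle_dec; lra.
Qed.

Lemma square_cont_h a b y : Rabs (a - fst c) < s -> Rabs (b - fst c) < s -> Rabs (y - snd c) < s ->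
  Ccont_on (fun x => q (x, y)) a b.
Proof.
intros Ha Hb Hy t Ht; destruct (Hq (t, y)) as [l Hl].
- split; [apply (interval_between _ a b); assumption | exact Hy].
- exact (Cder_cont_h _ _ _ _ Hl).
Qed.

Lemma square_cont_v a b x : Rabs (a - snd c) < s -> Rabs (b - snd c) < s -> Rabs (x - fst c) < s ->
  Ccont_on (fun y => q (x, y)) a b.
Proof.
intros Ha Hb Hx t Ht; destruct (Hq (x, t)) as [l Hl].
- split; [exact Hx | apply (interval_between _ a b); assumption].
- exact (Cder_cont_v _ _ _ _ Hl).
Qed.

(** Exchanging two endpoints only changes the sign, which reduces any order of them to the one in
    [Goursat]. *)
Lemma Goursat_square a b u v : Rabs (a - fst c) < s -> Rabs (b - fst c) < s ->
  Rabs (u - snd c) < s -> Rabs (v - snd c) < s -> rect_int q a b u v = 0%C.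
Proof.
intros Ha Hb Hu Hv.
assert (Hx : rect_int q b a u v = (- rect_int q a b u v)%C).
{ unfold rect_int.
  rewrite (CInt_swap _ a b (square_cont_h a b u Ha Hb Hu)), (CInt_swap _ a b (square_cont_h a b v Ha Hb Hv)).
  ring. }
assert (HG : forall a b u v, Rabs (a - fst c) < s -> Rabs (b - fst c) < s ->
  Rabs (u - snd c) < s -> Rabs (v - snd c) < s -> a <= b -> u <= v -> rect_int q a b u v = 0%C).
{ clear - Hq; intros a b u v Ha Hb Hu Hv Hab Huv; apply Goursat; try assumption.
  intros z [Hz1 Hz2]; apply Hq; split; [apply (interval_between _ a b) | apply (interval_between _ u v)];
  try assumption; rewrite Rmin_left, Rmax_right; assumption. }
assert (HG2 : forall a b u v, Rabs (a - fst c) < s -> Rabs (b - fst c) < s ->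
  Rabs (u - snd c) < s -> Rabs (v - snd c) < s -> a <= b -> rect_int q a b u v = 0%C).
{ clear - HG Hq; intros a b u v Ha Hb Hu Hv Hab.
  destruct (Rle_dec u v) as [H|H]; [apply HG; assumption|].
  assert (E : rect_int q a b u v = (- rect_int q a b v u)%C).
  { unfold rect_int.
    rewrite (CInt_swap _ v u (square_cont_v v u a Hv Hu Ha)), (CInt_swap _ v u (square_cont_v v u b Hv Hu Hb)).
    ring. }
  rewrite E, HG by (try assumption; lra). ring. }
destruct (Rle_dec a b) as [H|H]; [apply HG2; assumption|].
assert (E := HG2 b a u v Hb Ha Hu Hv ltac:(lra)). rewrite Hx in E.
replace (rect_int q a b u v) with (- - rect_int q a b u v)%C by ring. rewrite E; ring.
Qed.

(** $Q$ integrates $q$ from $c$ first horizontally, then vertically; that its increments have the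
    same shape from any starting point is Goursat's theorem. *)
Lemma square_primitive : 0 < s ->
  exists Q : C -> C, Q c = 0%C /\ forall z, square c s z -> Cder Q z (q z).
Proof.
intros Hs.
pose (Q := fun z : C => (CInt (fun t => q (t, snd c)) (fst c) (fst z) + Ci * CInt (fun t => q (fst z, t)) (snd c) (snd z))%C).
assert (Hc0 : Rabs (fst c - fst c) < s) by (rewrite Rminus_diag, Rabs_R0; exact Hs).
assert (Hc1 : Rabs (snd c - snd c) < s) by (rewrite Rminus_diag, Rabs_R0; exact Hs).
exists Q; split.
- unfold Q; rewrite !CInt_point; ring.
- intros z [Hz1 Hz2].
  (* Goursat on the rectangle between the heights of $c$ and $z$ lifts the horizontal path to the
     height of $z$. *)
  assert (Hdiff : forall w, square c s w -> (Q w - Q z)%C = (CInt (fun t => q (t, snd z)) (fst z) (fst w) + Ci * CInt (fun t => q (fst w, t)) (snd z) (snd w))%C).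
  { intros w [Hw1 Hw2]. unfold Q.
    rewrite <- (CInt_Chasles (fun t => q (t, snd c)) (fst c) (fst z) (fst w)) by (apply square_cont_h; assumption).
    rewrite <- (CInt_Chasles (fun t => q (fst w, t)) (snd c) (snd z) (snd w)) by (apply square_cont_v; assumption).
    assert (G := Goursat_square (fst z) (fst w) (snd c) (snd z) Hz1 Hw1 Hc1 Hz2).
    unfold rect_int in G.
    match goal with |- (?A + ?B + Ci * (?D + ?E) - (?A + Ci * ?F))%C = (?G1 + Ci * ?E)%C =>
      replace (A + B + Ci * (D + E) - (A + Ci * F))%C with ((B - G1 + Ci * (D - F)) + (G1 + Ci * E))%C by ring;
      rewrite G; ring end. }
  destruct (Hq z (conj Hz1 Hz2)) as [l Hl].
  apply Cder_spec; intros eps He.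
  destruct (Cder_cont _ _ _ Hl (eps / 2)) as [d [Hd Hd']]; [lra|].
  (* The path from $z$ to $w$ leaves each coordinate of $z$ by less than [d / 2], hence stays within
     [d] of $z$; the other terms keep $w$ in the square. *)
  pose (e := Rmin (d / 2) (Rmin (s - Rabs (fst z - fst c)) (s - Rabs (snd z - snd c)))).
  assert (He0 : 0 < e) by (unfold e; repeat apply Rmin_pos; lra).
  exists e; split; [exact He0|]; intros w Hw.
  destruct (Cmod_fst_snd (w - z)%C) as [Hf Hg].
  change (fst (w - z)%C) with (fst w - fst z) in Hf; change (snd (w - z)%C) with (snd w - snd z) in Hg.
  assert (Hwd : Cmod (w - z) < d / 2) by (eapply Rlt_le_trans; [exact Hw | apply Rmin_l]).
  assert (Hw1 : square c s w).
  { assert (X1 := Rabs_triang (fst w - fst z) (fst z - fst c)).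
    replace (fst w - fst z + (fst z - fst c)) with (fst w - fst c) in X1 by ring.
    assert (X2 := Rabs_triang (snd w - snd z) (snd z - snd c)).
    replace (snd w - snd z + (snd z - snd c)) with (snd w - snd c) in X2 by ring.
    revert Hw; unfold e, Rmin; repeat destruct Rle_dec; split; lra. }
  rewrite (Hdiff w Hw1). destruct Hw1 as [Hw1 Hw2].
  assert (E1 := CInt_minus (fun t => q (t, snd z)) (fun _ => q z) (fst z) (fst w) (square_cont_h _ _ _ Hz1 Hw1 Hz2)
     (fun x _ => continuous_const _ _)).
  assert (E2 := CInt_minus (fun t => q (fst w, t)) (fun _ => q z) (snd z) (snd w) (square_cont_v _ _ _ Hz2 Hw2 Hw1)
     (fun x _ => continuous_const _ _)).
  rewrite CInt_const in E1, E2.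
  assert (Eh : (w - z)%C = (RtoC (fst w - fst z) + Ci * RtoC (snd w - snd z))%C).
  { destruct w as [w1 w2], z as [z1 z2]; unfold Cminus, Cplus, Copp, Cmult, Ci, RtoC; simpl; f_equal; ring. }
  match goal with |- Cmod (?A + Ci * ?B - _) <= _ => 
    replace (A + Ci * B - q z * (w - z))%C with ((A - RtoC (fst w - fst z) * q z) + Ci * (B - RtoC (snd w - snd z) * q z))%C
    by (rewrite Eh; ring) end.
  rewrite <- E1, <- E2.
  eapply Rle_trans; [apply Cmod_triangle|]. rewrite Cmod_mult, Cmod_Ci, Rmult_1_l.
  assert (Hnear : forall t u, Rabs (t - fst z) <= Cmod (w - z) -> Rabs (u - snd z) <= Cmod (w - z) -> Cmod (q (t, u) - q z) <= eps / 2).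
  { intros t u Ht Hu; apply Rlt_le, Hd'.
    destruct z as [z1 z2]. eapply Rle_lt_trans; [apply (Cmod_le_abs (t + - z1) (u + - z2))|].
    simpl in Ht, Hu. unfold Rminus in Ht, Hu. lra. }
  assert (Hcc : forall h a b, Ccont_on h a b -> Ccont_on (fun t => (h t - q z)%C) a b).
  { intros h a b Hh x Hx; apply (continuous_minus (V := C_R_NormedModule) h (fun _ => q z)); [apply Hh, Hx | apply continuous_const]. }
  assert (Hbt : forall a b t, Rmin a b <= t <= Rmax a b -> Rabs (t - a) <= Rabs (b - a)).
  { intros a b t Ht; unfold Rabs; revert Ht; unfold Rmin, Rmax; destruct Rle_dec; repeat destruct Rcase_abs; lra. }
  assert (B1 := CInt_bound_abs (fun t => (q (t, snd z) - q z)%C) (fst z) (fst w) (eps / 2)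
    (Hcc _ _ _ (square_cont_h _ _ _ Hz1 Hw1 Hz2))).
  assert (B2 := CInt_bound_abs (fun t => (q (fst w, t) - q z)%C) (snd z) (snd w) (eps / 2)
    (Hcc _ _ _ (square_cont_v _ _ _ Hz2 Hw2 Hw1))).
  assert (B1' : Cmod (CInt (fun t => (q (t, snd z) - q z)%C) (fst z) (fst w)) <= Rabs (fst w - fst z) * (eps / 2)).
  { apply B1; intros x Hx; apply Hnear; [eapply Rle_trans; [apply (Hbt _ (fst w) _ Hx) | exact Hf]|].
    rewrite Rminus_diag, Rabs_R0; apply Cmod_ge_0. }
  assert (B2' : Cmod (CInt (fun t => (q (fst w, t) - q z)%C) (snd z) (snd w)) <= Rabs (snd w - snd z) * (eps / 2)).
  { apply B2; intros x Hx; apply Hnear; [exact Hf|]. eapply Rle_trans; [apply (Hbt _ (snd w) _ Hx) | exact Hg]. }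
  nra.
Qed.
End Square.

Lemma line_in_square c s z (t : R) : square c s z -> 0 <= t <= 1 -> square c s (c + t * (z - c))%C.
Proof.
intros [H1 H2] Ht; destruct z as [x y], c as [u v]; simpl in *.
split; simpl.
- replace (u + (t * (x + - u) - 0 * (y + - v)) - u) with (t * (x - u)) by ring.
  rewrite Rabs_mult, (Rabs_pos_eq t) by lra. generalize (Rabs_pos (x - u)); nra.
- replace (v + (t * (y + - v) + 0 * (x + - u)) - v) with (t * (y - v)) by ring.
  rewrite Rabs_mult, (Rabs_pos_eq t) by lra. generalize (Rabs_pos (y - v)); nra.
Qed.

Lemma ln_Cmod (z : C) : z <> 0%C -> ln (Cmod z) = ln (Re z * Re z + Im z * Im z) / 2.
Proof.
intros Hz.
assert (H := proj1 (Cmod_gt_0 z) Hz).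
assert (E : Re z * Re z + Im z * Im z = Cmod z * Cmod z).
{ generalize (Cmod2_alt z); simpl; lra. }
rewrite E, ln_mult by exact H. lra.
Qed.

(** $Q$ is a primitive of $f'/f$. Only its real part matters later, so it is not exponentiated:
    along the segment from $c$ to $z$, the function $\ln|f|-\mathrm{Re}\,Q$ has derivative $0$. *)
Lemma log_branch c s f df : 0 < s -> (forall z, Cder f z (df z)) -> (forall z, square c s z -> f z <> 0%C) ->
  exists Q, holo_on Q (square c s) /\ Q c = 0%C /\
    forall z, square c s z -> Re (Q z) = ln (Cmod (f z)) - ln (Cmod (f c)).
Proof.
intros Hs Hf Hnz.
destruct (square_primitive c s (fun z => df z / f z)%C) as [Q [Qc HQ]]; [|exact Hs|].
{ intros z Hz; destruct (derivative_holomorphic f df Hf z) as [l Hl].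
  eexists; apply Cder_div; [apply Hnz, Hz | exact Hl | apply Hf]. }
exists Q; split; [|split; [exact Qc|]].
{ intros z Hz; eexists; apply HQ, Hz. }
intros z Hz.
pose (p := fun t : R => (c + t * (z - c))%C).
assert (Hp : forall t, 0 <= t <= 1 -> square c s (p t)) by (intros t Ht; apply line_in_square; assumption).
(* $\ln|f|$ is written as $\frac12\ln((\mathrm{Re} f)^2+(\mathrm{Im} f)^2)$, which can be
   differentiated as a real function of $t$. *)
destruct (MVT_01 (fun t => ln (Re (f (p t)) * Re (f (p t)) + Im (f (p t)) * Im (f (p t))) / 2 - Re (Q (p t)))
  (fun _ => 0)) as [t [_ E]].
- intros t Ht.
  assert (D1 := Re_line _ _ _ _ _ (Hf (p t))).
  assert (D2 := Im_line _ _ _ _ _ (Hf (p t))).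
  assert (D3 := Re_line _ _ _ _ _ (HQ _ (Hp t Ht))).
  assert (Hn := Hnz _ (Hp t Ht)).
  fold (p t) in D1, D2, D3.
  change (is_derive (fun s0 : R => Re (f (p s0))) t (Re (df (p t) * (z - c)))) in D1.
  change (is_derive (fun s0 : R => Im (f (p s0))) t (Im (df (p t) * (z - c)))) in D2.
  change (is_derive (fun s0 : R => Re (Q (p s0))) t (Re (df (p t) / f (p t) * (z - c)))) in D3.
  assert (E3 : (df (p t) / f (p t) * (z - c))%C = ((df (p t) * (z - c)) * / f (p t))%C) by (unfold Cdiv; ring).
  rewrite E3 in D3; clear E3.
  revert D1 D2 D3 Hn.
  set (U := fun s0 => Re (f (p s0))). set (V := fun s0 => Im (f (p s0))). set (W := fun s0 => Re (Q (p s0))).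
  set (D := (df (p t) * (z - c))%C).
  intros D1 D2 D3 Hn.
  assert (HUV : 0 < U t * U t + V t * V t).
  { apply Cmod_gt_0 in Hn. unfold U, V. generalize (Cmod2_alt (f (p t))); simpl. nra. }
  change (is_derive (fun s0 => ln (U s0 * U s0 + V s0 * V s0) / 2 - W s0) t 0).
  auto_derive.
  + repeat split; try (eexists; eassumption). exact HUV.
  + change (fun x : R => U x) with U; change (fun x : R => V x) with V; change (fun x : R => W x) with W.
    rewrite (is_derive_unique _ _ _ D1), (is_derive_unique _ _ _ D2), (is_derive_unique _ _ _ D3).
    rewrite re_mult. 
    replace (Re (/ f (p t))) with (U t / (U t ^ 2 + V t ^ 2)) by (unfold U, V; reflexivity).
    replace (Im (/ f (p t))) with (- V t / (U t ^ 2 + V t ^ 2)) by (unfold U, V; reflexivity).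
    field. simpl; lra.
- unfold p in E. 
  replace (c + 1%R * (z - c))%C with z in E by ring. replace (c + 0%R * (z - c))%C with c in E by ring.
  rewrite Qc in E. rewrite !ln_Cmod.
  + rewrite re_RtoC in E; lra.
  + apply Hnz; split; rewrite Rminus_diag, Rabs_R0; exact Hs.
  + apply Hnz, Hz.
Qed.

(** * The maximum principle and its consequences *)

(** The mean of $\mathrm{Re}\,\chi$ over the circle is $\mathrm{Re}\,\chi(a)=0$. *)
Lemma mean_value_Re chi a s t m : holo_on chi (fun z => Cmod (z - a) < s) -> chi a = 0%C ->
  0 < t < s -> 0 < m -> ~ (forall th, Re (chi (circle a t th)) <= - m).
Proof.
intros Hchi Ha Ht Hm H.
assert (HPI := PI_RGT_0).
assert (Hc : Ccont_on (fun th => chi (circle a t th)) 0 (2 * PI)).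
{ intros x _; apply (Ccont_comp chi (circle a t)); [|apply circle_Ccont].
  destruct (Hchi (circle a t x)) as [l Hl]; [rewrite Cmod_circle; lra | exact (Cder_Cont _ _ _ Hl)]. }
assert (E := CInt_Re _ _ _ Hc).
destruct (Hchi a) as [l Hl]; [unfold Cminus; rewrite Cplus_opp_r, Cmod_0; lra|].
rewrite (mean_value chi a s t) in E.
- rewrite Ha, Cmult_0_r in E.
  assert (L := is_RInt_le _ _ 0 (2 * PI) _ _ ltac:(lra) E (is_RInt_const 0 (2 * PI) (- m)) (fun x _ => H x)).
  unfold scal in L; simpl in L; unfold mult in L; simpl in L. nra.
- intros z Hz; apply Hchi; lra.
- exact (Cder_Cont _ _ _ Hl).
- exact Ht.
Qed.

Lemma Cmod2_minus (a b : C) : Cmod b ^ 2 = Cmod a ^ 2 + Re (2 * Cconj a * (b - a))%C + Cmod (b - a) ^ 2.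
Proof. rewrite !Cmod2_alt; destruct a as [a1 a2], b as [b1 b2]; simpl; ring. Qed.

(** The term $\eta|w-c|^2$ makes interior maxima impossible. At such a maximum $m$, expand both
    squares about $m$: on a circle of radius $t$ the quadratic terms contribute at least $\eta t^2$,
    so the linear part, the real part of a holomorphic function vanishing at $m$, would be at most
    $-\eta t^2$ there. Finally $\eta\to0$. *)
Lemma maximum_principle_annulus f c d s B : 0 < d -> 0 <= B ->
  holo_on f (fun z => d <= Cmod (z - c) <= s) ->
  (forall z, Cmod (z - c) = d \/ Cmod (z - c) = s -> Cmod (f z) <= B) ->
  forall z, d <= Cmod (z - c) <= s -> Cmod (f z) <= B.
Proof.
intros Hd HB Hf Hbd z Hz.
assert (Heta : forall eta, 0 < eta -> Cmod (f z) ^ 2 <= B ^ 2 + eta * s ^ 2).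
{ intros eta He.
  destruct (compact_max _ (fun w => Cmod (f w) ^ 2 + eta * Cmod (w - c) ^ 2) (Ccompact_annulus c d s)) as [m [Km Hm]].
  - exists z; exact Hz.
  - intros w Hw eps Heps.
    destruct (Hf w Hw) as [l Hl].
    assert (C1 := Cont_Cmod _ _ (Cder_Cont _ _ _ Hl)).
    assert (C2 := Cont_Cmod _ _ (Cder_Cont _ _ _ (Cder_minus _ _ _ _ _ (Cder_id w) (Cder_const c w)))).
    cbv beta in C2.
    set (P := 1 + Cmod (f w)). set (P' := 1 + Cmod (w - c)).
    assert (HP : 1 <= P) by (unfold P; generalize (Cmod_ge_0 (f w)); lra).
    assert (HP' : 1 <= P') by (unfold P'; generalize (Cmod_ge_0 (w - c)); lra).
    destruct (C1 (Rmin 1 (eps / (4 * P)))) as [d1 [Hd1 H1]].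
    { apply Rmin_pos; [lra | apply Rdiv_lt_0_compat; lra]. }
    destruct (C2 (Rmin 1 (eps / (4 * eta * P')))) as [d2 [Hd2 H2]].
    { apply Rmin_pos; [lra | apply Rdiv_lt_0_compat; [lra | repeat apply Rmult_lt_0_compat; lra]]. }
    exists (Rmin d1 d2); split; [apply Rmin_pos; assumption|]; intros v Hv.
    specialize (H1 v (Rlt_le_trans _ _ _ Hv (Rmin_l _ _))).
    specialize (H2 v (Rlt_le_trans _ _ _ Hv (Rmin_r _ _))).
    assert (H1a := Rlt_le_trans _ _ _ H1 (Rmin_l _ _)).
    assert (H1b := Rlt_le_trans _ _ _ H1 (Rmin_r _ _)).
    assert (H2a := Rlt_le_trans _ _ _ H2 (Rmin_l _ _)).
    assert (H2b := Rlt_le_trans _ _ _ H2 (Rmin_r _ _)).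
    apply Rlt_div_r in H1b; [|lra].
    apply Rlt_div_r in H2b; [|repeat apply Rmult_lt_0_compat; lra].
    assert (Hsq : forall x y Q k, 0 <= y -> Q = 1 + y -> 0 < k -> Rabs (x - y) < 1 -> Rabs (x - y) * (4 * k * Q) < eps ->
      k * Rabs (x ^ 2 - y ^ 2) < eps / 2).
    { clear - Heps; intros x y Q k Hy -> Hk G1 G2.
      replace (x ^ 2 - y ^ 2) with ((x - y) * (x + y)) by ring. rewrite Rabs_mult.
      assert (Rabs (x + y) <= 2 * (1 + y)).
      { replace (x + y) with ((x - y) + 2 * y) by ring. eapply Rle_trans; [apply Rabs_triang|].
        rewrite (Rabs_pos_eq (2 * y)) by lra. lra. }
      assert (P := Rabs_pos (x - y)).
      apply Rle_lt_trans with (k * (Rabs (x - y) * (2 * (1 + y)))).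
      - apply Rmult_le_compat_l; [lra|]. apply Rmult_le_compat_l; assumption.
      - lra. }
    assert (S1 := Hsq _ _ P 1 (Cmod_ge_0 (f w)) eq_refl Rlt_0_1 H1a ltac:(lra)).
    assert (S2 := Hsq _ _ P' eta (Cmod_ge_0 (w - c)) eq_refl He H2a ltac:(lra)).
    replace (Cmod (f v) ^ 2 + eta * Cmod (v - c) ^ 2 - (Cmod (f w) ^ 2 + eta * Cmod (w - c) ^ 2))
      with ((Cmod (f v) ^ 2 - Cmod (f w) ^ 2) + eta * (Cmod (v - c) ^ 2 - Cmod (w - c) ^ 2)) by ring.
    eapply Rle_lt_trans; [apply Rabs_triang|]. rewrite (Rabs_mult eta), (Rabs_pos_eq eta) by lra. lra.
  - apply Rle_trans with (Cmod (f m) ^ 2 + eta * Cmod (m - c) ^ 2).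
    { specialize (Hm z Hz). assert (0 <= eta * Cmod (z - c) ^ 2) by (apply Rmult_le_pos; [lra | apply pow2_ge_0]). lra. }
    destruct (Req_dec (Cmod (m - c)) d) as [Ed|Nd]; [|destruct (Req_dec (Cmod (m - c)) s) as [Es|Ns]].
    + apply Rplus_le_compat.
      * apply pow_incr; split; [apply Cmod_ge_0 | apply Hbd; left; exact Ed].
      * apply Rmult_le_compat_l; [lra|]. apply pow_incr; split; [apply Cmod_ge_0 | apply Km].
    + apply Rplus_le_compat.
      * apply pow_incr; split; [apply Cmod_ge_0 | apply Hbd; right; exact Es].
      * apply Rmult_le_compat_l; [lra|]. apply pow_incr; split; [apply Cmod_ge_0 | apply Km].
    + exfalso.
      pose (t := Rmin (Cmod (m - c) - d) (s - Cmod (m - c)) / 2).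
      assert (Ht : 0 < t) by (unfold t; apply Rdiv_lt_0_compat; [apply Rmin_pos; lra | lra]).
      assert (Ht1 : 2 * t <= Cmod (m - c) - d) by (unfold t; generalize (Rmin_l (Cmod (m - c) - d) (s - Cmod (m - c))); lra).
      assert (Ht2 : 2 * t <= s - Cmod (m - c)) by (unfold t; generalize (Rmin_r (Cmod (m - c) - d) (s - Cmod (m - c))); lra).
      assert (Hin : forall w, Cmod (w - m) < 2 * t -> d <= Cmod (w - c) <= s).
      { intros w Hw. assert (T := Cmod_rev_triangle (w - c) (m - c)).
        replace (w - c - (m - c))%C with (w - m)%C in T by ring.
        apply Rabs_le_between in T; lra. }
      (* The linear terms of [Cmod2_minus] for $f$ and for $w-c$, before taking real parts. *)
      pose (chi := fun w => (2 * Cconj (f m) * (f w - f m) + RtoC eta * (2 * Cconj (m - c) * ((w - c) - (m - c))))%C).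
      apply (mean_value_Re chi m (2 * t) t (eta * t ^ 2)).
      * intros w Hw. destruct (Hf w (Hin w Hw)) as [l Hl].
        eexists; unfold chi. apply Cder_plus.
        -- apply Cder_mult; [apply Cder_const | apply Cder_minus; [exact Hl | apply Cder_const]].
        -- apply Cder_mult; [apply Cder_const|]. apply Cder_mult; [apply Cder_const|].
           apply Cder_minus; [|apply Cder_const]. apply Cder_minus; [apply Cder_id | apply Cder_const].
      * unfold chi; ring.
      * lra.
      * apply Rmult_lt_0_compat; [lra | apply pow_lt; lra].
      * intros th. set (w := circle m t th).
        assert (Hw : Cmod (w - m) = t) by (apply Cmod_circle; lra).
        assert (Hwm := Hm w (Hin w ltac:(lra))).
        rewrite (Cmod2_minus (f m) (f w)), (Cmod2_minus (m - c) (w - c)) in Hwm.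
        replace (w - c - (m - c))%C with (w - m)%C in Hwm at 2 by ring. rewrite Hw in Hwm.
        unfold chi. rewrite re_plus, re_scal_l.
        generalize (pow2_ge_0 (Cmod (f w - f m))); lra. }
assert (H2 : Cmod (f z) ^ 2 <= B ^ 2).
{ apply le_epsilon; intros eps He.
  eapply Rle_trans; [apply (Heta (eps / (1 + s ^ 2)))|].
  - apply Rdiv_lt_0_compat; [lra | generalize (pow2_ge_0 s); lra].
  - apply Rplus_le_compat_l. assert (P := pow2_ge_0 s).
    apply Rmult_le_reg_l with (1 + s ^ 2); [lra|].
    replace ((1 + s ^ 2) * (eps / (1 + s ^ 2) * s ^ 2)) with (eps * s ^ 2) by (field; lra). nra. }
apply Rsqr_incr_0_var; [|exact HB]. unfold Rsqr; simpl in H2; lra.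
Qed.

(** The maximum principle for $f(z)/(z-c)^p$, whose modulus is at most $e/d^p$ on the inner circle
    and $M/s^p$ on the outer one. *)
Lemma annulus_bound f c d s (p : nat) e M : 0 < d -> 0 < s ->
  holo_on f (fun z => d <= Cmod (z - c) <= s) ->
  (forall z, Cmod (z - c) = d -> Cmod (f z) <= e) ->
  (forall z, Cmod (z - c) = s -> Cmod (f z) <= M) -> 0 <= M ->
  forall z, d <= Cmod (z - c) <= s -> Cmod (f z) <= Rmax (e / d ^ p) (M / s ^ p) * Cmod (z - c) ^ p.
Proof.
intros Hd Hs Hf He HM HM0 z Hz.
assert (Hnz : forall w, d <= Cmod (w - c) -> (w - c)%C <> 0%C).
{ intros w Hw; apply Cmod_gt_0; lra. }
assert (Hdp := pow_lt _ p Hd). assert (Hsp := pow_lt _ p Hs).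
assert (H := maximum_principle_annulus (fun w => (f w / (w - c) ^ p)%C) c d s (Rmax (e / d ^ p) (M / s ^ p)) Hd).
assert (Hq : forall w, d <= Cmod (w - c) -> Cmod (f w / (w - c) ^ p)%C = Cmod (f w) / Cmod (w - c) ^ p).
{ intros w Hw; rewrite Cmod_div, Cmod_pow; [reflexivity | apply Cpow_nz, Hnz, Hw]. }
assert (Hzp : 0 < Cmod (z - c) ^ p) by (apply pow_lt; lra).
apply Rle_div_l; [exact Hzp|]. rewrite <- Hq by lra.
apply H; [| | |exact Hz].
- eapply Rle_trans; [|apply Rmax_r]. apply Rmult_le_pos; [exact HM0 | apply Rlt_le, Rinv_0_lt_compat, Hsp].
- intros w Hw; destruct (Hf w Hw) as [l Hl]; destruct (Cder_pow (w - c)%C p) as [k Hk].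
  eexists; apply Cder_div; [apply Cpow_nz, Hnz, Hw | exact Hl |].
  apply (Cder_comp (fun u => u ^ p)%C (fun u => u - c)%C); [exact Hk|].
  apply Cder_minus; [apply Cder_id | apply Cder_const].
- intros w Hw. destruct (Rle_dec d s) as [Hds|Hds]; [|exfalso; lra].
  rewrite Hq by (destruct Hw; lra). destruct Hw as [Hw|Hw]; rewrite Hw.
  + eapply Rle_trans; [|apply Rmax_l]. apply Rmult_le_compat_r; [apply Rlt_le, Rinv_0_lt_compat, Hdp | apply He, Hw].
  + eapply Rle_trans; [|apply Rmax_r]. apply Rmult_le_compat_r; [apply Rlt_le, Rinv_0_lt_compat, Hsp | apply HM, Hw].
Qed.

(* The maximum principle for [f z / (z - c) ^ p] with [p] large. *)
Lemma small_propagation d rho s M eta : 0 < d -> 0 < rho < s -> 0 <= M -> 0 < eta ->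
  exists eps, 0 < eps /\ forall f c,
    holo_on f (fun z => Cmod (z - c) <= s) ->
    (forall z, Cmod (z - c) <= d -> Cmod (f z) <= eps) ->
    (forall z, Cmod (z - c) <= s -> Cmod (f z) <= M) ->
    forall z, Cmod (z - c) <= rho -> Cmod (f z) <= eta.
Proof.
intros Hd Hrho HM Heta.
assert (Hq : 0 <= rho / s < 1).
{ split; [apply Rmult_le_pos; [lra | apply Rlt_le, Rinv_0_lt_compat; lra] | apply Rlt_div_l; lra]. }
(* $p$ is chosen with $M(\rho/s)^p<\eta$, which settles the outer circle; $\varepsilon\le\eta
   d^p/\rho^p$ then settles the inner one. *)
destruct (pow_lt_1_zero (rho / s) ltac:(rewrite Rabs_pos_eq; lra) (eta / (M + 1))) as [p Hp].
{ apply Rdiv_lt_0_compat; lra. }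
specialize (Hp p (le_n p)). rewrite Rabs_pos_eq in Hp by (apply pow_le; lra).
apply Rlt_div_r in Hp; [|lra].
assert (Hdp := pow_lt _ p Hd). assert (Hsp := pow_lt s p ltac:(lra)). assert (Hrp := pow_lt rho p ltac:(lra)).
exists (Rmin eta (eta * d ^ p / rho ^ p)); split.
{ apply Rmin_pos; [lra|]. apply Rdiv_lt_0_compat; [apply Rmult_lt_0_compat; lra | exact Hrp]. }
intros f c Hf He HfM z Hz.
destruct (Rle_dec (Cmod (z - c)) d) as [H|H].
{ eapply Rle_trans; [apply He, H | apply Rmin_l]. }
assert (A := annulus_bound f c d s p (eta * d ^ p / rho ^ p) M Hd ltac:(lra)).
eapply Rle_trans; [apply A|].
- intros w Hw; apply Hf; lra.
- intros w Hw; eapply Rle_trans; [apply He; lra | apply Rmin_r].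
- intros w Hw; apply HfM; lra.
- exact HM.
- lra.
- apply Rle_trans with (Rmax (eta * d ^ p / rho ^ p / d ^ p) (M / s ^ p) * rho ^ p).
  + apply Rmult_le_compat_l.
    * eapply Rle_trans; [|apply Rmax_r]. apply Rmult_le_pos; [exact HM | apply Rlt_le, Rinv_0_lt_compat, Hsp].
    * apply pow_incr; split; [apply Cmod_ge_0 | exact Hz].
  + unfold Rmax; destruct Rle_dec as [_|_].
    * unfold Rdiv in Hp at 1. rewrite Rpow_mult_distr, pow_inv in Hp.
      assert (0 <= rho ^ p * / s ^ p) by (apply Rmult_le_pos; [lra | apply Rlt_le, Rinv_0_lt_compat, Hsp]).
      unfold Rdiv. lra.
    * right; field; lra.
Qed.

(* A weak Schwarz lemma for [psi = G / (2 A - G)]: the maximum principle for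
   [psi ^ 2 / (z - c)] gives [|psi z| ^ 2 <= |z - c| / s]. *)
Lemma Borel_Caratheodory G c s A : 0 < s -> 0 < A ->
  holo_on G (fun z => Cmod (z - c) <= s) -> G c = 0%C ->
  (forall z, Cmod (z - c) <= s -> Re (G z) <= A) ->
  forall z, Cmod (z - c) <= s / 4 -> Cmod (G z) <= 2 * A.
Proof.
intros Hs HA HG Gc HRe z Hz.
pose (psi := fun w => (G w / (RtoC (2 * A) - G w))%C).
assert (Hnz : forall w, Cmod (w - c) <= s -> (RtoC (2 * A) - G w)%C <> 0%C).
{ intros w Hw E; specialize (HRe w Hw).
  assert (E' : Re (RtoC (2 * A) - G w)%C = 0) by (rewrite E; reflexivity).
  unfold Cminus in E'; rewrite re_plus, re_opp, re_RtoC in E'; lra. }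
assert (Hpsi : holo_on psi (fun w => Cmod (w - c) <= s)).
{ intros w Hw; destruct (HG w Hw) as [l Hl]; eexists; unfold psi; apply Cder_div.
  - apply Hnz, Hw.
  - exact Hl.
  - apply Cder_minus; [apply Cder_const | exact Hl]. }
assert (Hc0 : Cmod (c - c) = 0) by (unfold Cminus; rewrite Cplus_opp_r; apply Cmod_0).
assert (psic : psi c = 0%C) by (unfold psi; rewrite Gc; unfold Cdiv; ring).
assert (Hpsi1 : forall w, Cmod (w - c) <= s -> Cmod (psi w) <= 1).
{ intros w Hw; unfold psi; rewrite Cmod_div by (apply Hnz, Hw).
  assert (P := proj1 (Cmod_gt_0 _) (Hnz w Hw)).
  apply Rle_div_l; [exact P|]. rewrite Rmult_1_l.
  (* $|2A-G|^2-|G|^2=4A(A-\mathrm{Re}\,G)\ge0$. *)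
  apply Rsqr_incr_0_var; [|lra]. rewrite !Rsqr_pow2, !Cmod2_alt.
  unfold Cminus; rewrite re_plus, re_opp, re_RtoC, im_plus, im_opp, im_RtoC.
  specialize (HRe w Hw). nra. }
assert (Hhalf : Cmod (psi z) <= / 2).
{ destruct (Hpsi c ltac:(lra)) as [l Hl].
  destruct (proj1 (Cder_spec _ _ _) Hl 1 Rlt_0_1) as [d0 [Hd0 Hd0']].
  destruct (Req_dec (Cmod (z - c)) 0) as [E|NE].
  { apply Cmod_eq_0 in E; apply Ceq_minus in E; rewrite E, psic, Cmod_0; lra. }
  assert (Hzc := Cmod_ge_0 (z - c)).
  set (K := 1 + Cmod l).
  assert (HK : 1 <= K) by (unfold K; generalize (Cmod_ge_0 l); lra).
  (* Since $\psi(c)=0$, one has $|\psi|\le Kd$ on the inner circle. Squaring makes the quotient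
     there at most $K^2d$, which the last term brings below $1/s$, the bound on the outer circle. *)
  pose (d := Rmin (Rmin (d0 / 2) (Cmod (z - c))) (/ (s * K ^ 2))).
  assert (HKK : 0 < s * K ^ 2) by (apply Rmult_lt_0_compat; [lra | apply pow_lt; lra]).
  assert (Hd : 0 < d) by (unfold d; repeat apply Rmin_pos; try lra; apply Rinv_0_lt_compat, HKK).
  assert (D1 : d <= d0 / 2) by (eapply Rle_trans; [apply Rmin_l | apply Rmin_l]).
  assert (D2 : d <= Cmod (z - c)) by (eapply Rle_trans; [apply Rmin_l | apply Rmin_r]).
  assert (D3 : d <= / (s * K ^ 2)) by apply Rmin_r.
  assert (H := annulus_bound (fun w => (psi w * psi w)%C) c d s 1 ((K * d) ^ 2) 1 Hd Hs).
  assert (B : Cmod (psi z * psi z) <= Rmax ((K * d) ^ 2 / d ^ 1) (1 / s ^ 1) * Cmod (z - c) ^ 1).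
  { apply H; try lra.
    - intros w Hw; destruct (Hpsi w ltac:(lra)) as [k Hk]; eexists; apply Cder_mult; exact Hk.
    - intros w Hw. rewrite Cmod_mult. specialize (Hd0' w ltac:(lra)). rewrite psic in Hd0'.
      assert (Cmod (psi w) <= K * d).
      { replace (psi w) with ((psi w - 0 - l * (w - c)) + l * (w - c))%C by ring.
        eapply Rle_trans; [apply Cmod_triangle|]. rewrite Cmod_mult, Hw in *. unfold K; lra. }
      generalize (Cmod_ge_0 (psi w)); nra.
    - intros w Hw; rewrite Cmod_mult; specialize (Hpsi1 w ltac:(lra)); generalize (Cmod_ge_0 (psi w)); nra. }
  assert (HM : Rmax ((K * d) ^ 2 / d ^ 1) (1 / s ^ 1) <= / s).
  { apply Rmax_lub.
    - replace ((K * d) ^ 2 / d ^ 1) with (K ^ 2 * d) by (field; lra).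
      apply Rle_trans with (K ^ 2 * / (s * K ^ 2)).
      + apply Rmult_le_compat_l; [apply pow2_ge_0 | exact D3].
      + right; field; split; lra.
    - right; field; lra. }
  rewrite Cmod_mult in B; rewrite !pow_1 in B, HM.
  assert (B' : Cmod (psi z) * Cmod (psi z) <= / 4).
  { eapply Rle_trans; [exact B|]. apply Rle_trans with (/ s * (s / 4)).
    - apply Rmult_le_compat; try lra. eapply Rle_trans; [|apply Rmax_r]. apply Rmult_le_pos; [lra|]. apply Rlt_le, Rinv_0_lt_compat, Hs.
    - right; field; lra. }
  apply Rsqr_incr_0_var; [unfold Rsqr; lra | lra]. }
assert (Hz' : Cmod (z - c) <= s) by lra.
assert (E : G z = (psi z * (RtoC (2 * A) - G z))%C) by (specialize (Hnz z Hz'); unfold psi; revert Hnz; generalize (RtoC (2 * A)) (G z); intros u v Huv; field; exact Huv).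
assert (E2 : Cmod (G z) <= / 2 * (2 * A + Cmod (G z))).
{ rewrite E at 1; rewrite Cmod_mult. apply Rmult_le_compat; try apply Cmod_ge_0; [exact Hhalf|].
  unfold Cminus; eapply Rle_trans; [apply Cmod_triangle|]. rewrite Cmod_opp, Cmod_R, Rabs_pos_eq; lra. }
lra.
Qed.

(** Upper bounds for the real part become bounds for $|G|$ at the price of a factor 4 in the radius:
    $\varepsilon$ on $d/4$ and $2A$ on $s/4$. Between these [small_propagation] reaches $s/8$. *)
Lemma Re_small_propagation d s A eta : 0 < d < s -> 0 < A -> 0 < eta ->
  exists eps, 0 < eps /\ forall G c,
    holo_on G (fun z => Cmod (z - c) <= s) -> G c = 0%C ->
    (forall z, Cmod (z - c) <= s -> Re (G z) <= A) ->
    (forall z, Cmod (z - c) <= d -> Re (G z) <= eps) ->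
    forall z, Cmod (z - c) <= s / 8 -> Cmod (G z) <= eta.
Proof.
intros Hd HA Heta.
destruct (small_propagation (d / 4) (s / 8) (s / 4) (2 * A) eta) as [eps [He H]]; try lra.
exists (eps / 2); split; [lra|]; intros G c HG Gc HRe Hsm.
apply H.
- intros w Hw; apply HG; lra.
- intros w Hw. replace eps with (2 * (eps / 2)) by lra.
  apply (Borel_Caratheodory G c d); try lra; try assumption.
  intros u Hu; apply HG; lra.
- intros w Hw; apply (Borel_Caratheodory G c s); try lra; assumption.
Qed.

(** * Zeros and the growth function *)

Lemma tends_to_eventually u l eps : tends_to u l -> 0 < eps -> eventually (fun n => Cmod (u n - l) < eps).
Proof.
intros H He; apply (H (fun w => Cmod (w - l) < eps)).
apply (Copen_disc l eps l). unfold Cminus; rewrite Cplus_opp_r, Cmod_0; exact He.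
Qed.

(** * Level sets of the height and bounds on the growth function *)

Lemma height_Rcont omega : proper_height omega -> forall z, Rcont omega z.
Proof.
intros H z eps He.
assert (L := proj1 (filterlim_locally _ _) (height_continuous _ H z) (mkposreal eps He)).
destruct (proj1 (locally_C z _) L) as [d Hd].
exists d; split; [apply cond_pos | exact Hd].
Qed.

Lemma Copen_sublevel omega s : proper_height omega -> Copen (sublevel omega s).
Proof.
intros H; apply Copen_spec; intros z Hz.
destruct (height_Rcont omega H z (s - omega z)) as [d [Hd Hd']]; [unfold sublevel in Hz; lra|].
exists d; split; [exact Hd|]; intros w Hw; specialize (Hd' w Hw); apply Rabs_def2 in Hd'; unfold sublevel; lra.
Qed.

Lemma Copen_superlevel omega s : proper_height omega -> Copen (fun z => s < omega z).
Proof.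
intros H; apply Copen_spec; intros z Hz.
destruct (height_Rcont omega H z (omega z - s)) as [d [Hd Hd']]; [lra|].
exists d; split; [exact Hd|]; intros w Hw; specialize (Hd' w Hw); apply Rabs_def2 in Hd'; lra.
Qed.

Lemma Copen_and U V : Copen U -> Copen V -> Copen (fun z => U z /\ V z).
Proof.
intros HU HV; apply (open_and (T := C_UniformSpace)); assumption.
Qed.

Lemma height_above_off_level omega rho r U z : proper_height omega -> 0 < rho ->
  rho <= omega z -> Copen U -> U z -> exists w, U w /\ rho < omega w /\ omega w <> r.
Proof.
intros H Hrho Hz HU Uz.
destruct (proj2 (height_closure _ H rho Hrho z) Hz U HU Uz) as [w1 [U1 H1]].
destruct (Req_dec (omega w1) r) as [E|E]; [|exists w1; auto].
assert (Hr : 0 < r) by lra.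
destruct (proj2 (height_closure _ H r Hr w1) ltac:(lra) (fun w => U w /\ rho < omega w)) as [w2 [[U2 H2] H3]].
- apply Copen_and; [exact HU | apply Copen_superlevel, H].
- split; assumption.
- exists w2; repeat split; [exact U2 | exact H2 | lra].
Qed.

Lemma eventually_ge lambda M : is_lim_seq lambda p_infty -> eventually (fun n => M < lambda n).
Proof. intros H; apply is_lim_seq_spec in H; exact (H M). Qed.

(** The bound gives $\mu(z)\le\exp(e)$ for every $e>0$. Both uses of $\mu>1$, against convergence
    and against missing zeros, go through this criterion. *)
Lemma growth_le_1 f lambda z : is_lim_seq lambda p_infty ->
  (forall e, 0 < e -> eventually (fun n => Cmod (f n z) <= exp (e * lambda n))) ->
  ~ Rbar_lt 1 (growth_function f lambda z).
Proof.
intros Hl H.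
assert (Hle : forall e, 0 < e -> Rbar_le (growth_function f lambda z) (exp e)).
{ intros e He; rewrite <- (LimSup_seq_const (exp e)).
  apply LimSup_le. generalize (filter_and _ _ (H e He) (eventually_ge lambda 0 Hl)).
  apply filter_imp; intros n [Hn Hn0]. unfold root_modulus, rpow.
  destruct Rlt_dec as [P|P]; [|apply Rlt_le, exp_pos].
  apply ln_le in Hn; [|exact P]. rewrite ln_exp in Hn.
  assert (E : / lambda n * ln (Cmod (f n z)) <= e).
  { apply Rmult_le_reg_l with (lambda n); [exact Hn0|]. rewrite <- Rmult_assoc, Rinv_r, Rmult_1_l by lra. lra. }
  unfold Rpower; destruct E as [E|E]; [apply Rlt_le, exp_increasing, E | rewrite E; apply Rle_refl]. }
destruct (growth_function f lambda z) as [x| |]; simpl; intros Hlt; [|exact (Hle 1 Rlt_0_1)|exact Hlt].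
assert (Hx : 0 < ln x) by (rewrite <- ln_1; apply ln_increasing; lra).
specialize (Hle (ln x / 2) ltac:(lra)); simpl in Hle.
assert (exp (ln x / 2) < exp (ln x)) by (apply exp_increasing; lra).
rewrite exp_ln in H0 by lra. lra.
Qed.

(** A convergent sequence is eventually below $|l|+1$, and a constant is below $\exp(e\lambda_n)$
    for large $n$. *)
Lemma convergent_growth f lambda z l : is_lim_seq lambda p_infty -> tends_to (fun n => f n z) l ->
  ~ Rbar_lt 1 (growth_function f lambda z).
Proof.
intros Hl Hz; apply growth_le_1; [exact Hl|]; intros e He.
generalize (filter_and _ _ (tends_to_eventually _ _ 1 Hz Rlt_0_1) (eventually_ge lambda (ln (Cmod l + 1) / e) Hl)).
apply filter_imp; intros n [H1 H2].
assert (P := Cmod_ge_0 l).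
apply Rle_trans with (Cmod l + 1).
- replace (f n z) with ((f n z - l) + l)%C by ring. eapply Rle_trans; [apply Cmod_triangle | lra].
- rewrite <- (exp_ln (Cmod l + 1)) at 1 by lra. apply Rlt_le, exp_increasing.
  apply Rlt_div_l in H2; lra.
Qed.

Lemma admissible_bound f lambda c s : (forall n, entire (f n)) -> admissible_exponents f lambda -> 
  exists B, 0 < B /\ eventually (fun n => forall z, Cmod (z - c) <= s -> Cmod (f n z) <= exp (lambda n * B)).
Proof.
intros Hf [_ [Hlim Hadm]].
pose (K := fun z => 0 <= Cmod (z - c) <= s).
destruct (Hadm K (Ccompact_annulus c 0 s)) as [b Hb].
assert (Hev : eventually (fun n => max_on K (root_modulus f lambda n) < b + 1)).
{ assert (L := proj2_sig (ex_LimSup_seq (fun n => max_on K (root_modulus f lambda n)))).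
  change (is_LimSup_seq (fun n => max_on K (root_modulus f lambda n)) (LimSup_seq (fun n => max_on K (root_modulus f lambda n)))) in L.
  destruct (LimSup_seq _) as [x| |]; simpl in Hb.
  - destruct (L (mkposreal 1 Rlt_0_1)) as [_ [N HN]]; exists N; intros n Hn; specialize (HN n Hn); simpl in HN; lra.
  - contradiction.
  - destruct (L (b + 1)) as [N HN]; exists N; exact HN. }
(* The maximum with 2 makes the exponent [ln b'] positive. *)
pose (b' := Rmax (b + 1) 2).
assert (Hb' : 2 <= b') by apply Rmax_r.
assert (Hbb' : b + 1 <= b') by apply Rmax_l.
exists (ln b'); split; [rewrite <- ln_1; apply ln_increasing; lra|].
generalize (filter_and _ _ Hev (eventually_ge lambda 0 Hlim)).
apply filter_imp; intros n [Hn Hn0] z Hz.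
assert (Kz : K z) by (split; [apply Cmod_ge_0 | exact Hz]).
destruct (Rlt_dec 0 (Cmod (f n z))) as [P|P].
2:{ apply Rle_trans with 0; [lra | apply Rlt_le, exp_pos]. }
destruct (disc_bound c s (f n)) as [M [HM HfM]].
{ intros w _; destruct (Hf n w) as [l Hl]; exact (Cder_Cont _ _ _ Hl). }
assert (Hroot : root_modulus f lambda n z <= max_on K (root_modulus f lambda n)).
(* An infinite supremum would have the default real value $0$; boundedness of $f_n$ on the disc
   excludes this case. *)
{ unfold max_on.
  destruct (Lub_Rbar_correct (fun y => exists z0, K z0 /\ y = root_modulus f lambda n z0)) as [L1 L2].
  destruct (Lub_Rbar _) as [x| |].
  - apply (L1 (root_modulus f lambda n z)); exists z; split; [exact Kz | reflexivity].
  - exfalso. specialize (L2 (Finite (Rmax 1 (Rpower M (/ lambda n))))). apply L2.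
    intros y [w [[_ Kw] ->]]; simpl. unfold root_modulus, rpow; destruct Rlt_dec as [Q|Q].
    + eapply Rle_trans; [|apply Rmax_r].
      apply Rle_Rpower_l; [apply Rlt_le, Rinv_0_lt_compat, Hn0|]. split; [exact Q | apply HfM, Kw].
    + eapply Rle_trans; [|apply Rmax_l]; lra.
  - exfalso. apply (L1 (root_modulus f lambda n z)); exists z; split; [exact Kz | reflexivity]. }
assert (Hr : root_modulus f lambda n z <= b') by lra.
unfold root_modulus, rpow in Hr; destruct Rlt_dec as [_|N]; [|contradiction].
assert (E : / lambda n * ln (Cmod (f n z)) <= ln b').
{ rewrite <- (ln_exp (/ lambda n * ln (Cmod (f n z)))). apply ln_le; [apply exp_pos | exact Hr]. }
rewrite <- (exp_ln (Cmod (f n z))) by exact P.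
assert (E2 : ln (Cmod (f n z)) <= lambda n * ln b').
{ apply Rmult_le_reg_l with (/ lambda n); [apply Rinv_0_lt_compat, Hn0|].
  rewrite <- Rmult_assoc, Rinv_l, Rmult_1_l by lra. exact E. }
destruct E2 as [E2|E2]; [apply Rlt_le, exp_increasing, E2 | rewrite E2; lra].
Qed.

(** * The sequence inside $D_\rho$ and across its boundary *)

Section Level.
Variables (omega : C -> R) (f : nat -> C -> C) (rho : R) (g : C -> C).
Hypothesis (homega : proper_height omega) (hf : forall n, entire (f n))
  (hlevel : convergence_level omega f = Finite rho)
  (hg : forall z, sublevel omega rho z -> tends_to (fun n => f n z) (g z)).

Lemma entire_Cder n z : Cder (f n) z (C_derive (f n) z).
Proof. apply (C_derive_correct (f n) z 0%C), hf. Qed.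

(** $\omega$ attains a maximum below $\rho$ on $K$, so $K$ lies in some $D_{r'}$ of compact
    convergence; the limit there agrees with the pointwise limit $g$. *)
Lemma level_uniform K : Ccompact K -> (forall z, K z -> omega z < rho) ->
  converges_uniformly_to_on f g K.
Proof.
intros HK Hin.
destruct (classic (exists z, K z)) as [Hne|Hne].
2:{ intros eps; exists O; intros n _ z Hz; exfalso; apply Hne; exists z; exact Hz. }
destruct (compact_max K omega HK Hne (fun z _ => height_Rcont omega homega z)) as [m [Km Hm]].
assert (Hm0 := height_nonneg _ homega m).
assert (Hex : exists r', omega m < r' /\ converges_compactly_on f (sublevel omega r')).
(* Otherwise $\omega(m)<\rho$ would be an upper bound of the set whose supremum is $\rho$; for its
   added element $0$ this uses $\omega\ge0$. *)
{ apply NNPP; intros Hno.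
  destruct (Lub_Rbar_correct (fun r => r = 0 \/ (0 < r /\ converges_compactly_on f (sublevel omega r)))) as [_ L2].
  fold (convergence_level omega f) in L2. rewrite hlevel in L2.
  specialize (L2 (Finite (omega m))). specialize (Hin m Km).
  assert (rho <= omega m); [|lra]. apply L2.
  intros r' [->|[_ Hr']]; simpl; [exact Hm0|].
  apply Rnot_lt_le; intros Hlt; apply Hno; exists r'; split; assumption. }
destruct Hex as [r' [Hr' [g' Hg']]].
specialize (Hg' K HK (fun z Kz => Rle_lt_trans _ _ _ (Hm z Kz) Hr')).
assert (E : forall z, K z -> g' z = g z).
{ intros z Kz; apply Ceq_minus, Cmod_eq_0, Rle_antisym; [|apply Cmod_ge_0].
  apply le_epsilon; intros eps He; rewrite Rplus_0_l.
  assert (He2 : 0 < eps / 2) by lra.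
  destruct (filter_and _ _ (Hg' (mkposreal _ He2)) (tends_to_eventually _ _ (eps / 2) (hg z (Hin z Kz)) He2)) as [N HN].
  destruct (HN N (le_n N)) as [H1 H2]; specialize (H1 z Kz); simpl in H1.
  replace (g' z - g z)%C with (- (f N z - g' z) + (f N z - g z))%C by ring.
  eapply Rle_trans; [apply Cmod_triangle|]. rewrite Cmod_opp; lra. }
intros eps. generalize (Hg' eps); apply filter_imp; intros n Hn z Kz.
rewrite <- (E z Kz); apply Hn, Kz.
Qed.

Lemma level_disc_bound c s : (forall z, Cmod (z - c) <= s -> omega z < rho) ->
  exists M, 0 < M /\ eventually (fun n => forall z, Cmod (z - c) <= s -> Cmod (f n z) <= M).
Proof.
intros Hin.
destruct (level_uniform _ (Ccompact_annulus c 0 s) (fun z Kz => Hin z (proj2 Kz)) (mkposreal 1 Rlt_0_1)) as [N HN].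
simpl in HN.
destruct (disc_bound c s (f N)) as [M [HM HfM]].
{ intros z _; exact (Cder_Cont _ _ _ (entire_Cder N z)). }
(* Both $f_n$ and $f_N$ are within 1 of $g$, so a bound for the single entire function $f_N$
   suffices and $g$ need not be bounded directly. *)
exists (M + 2); split; [lra|]; exists N; intros n Hn z Hz.
assert (Kz : 0 <= Cmod (z - c) <= s) by (split; [apply Cmod_ge_0 | exact Hz]).
assert (H1 := HN n Hn z Kz). assert (H2 := HN N (le_n N) z Kz). specialize (HfM z Hz).
replace (f n z) with ((f n z - g z) + (- (f N z - g z) + f N z))%C by ring.
eapply Rle_trans; [apply Cmod_triangle|].
eapply Rle_trans; [apply Rplus_le_compat_l, Cmod_triangle|]. rewrite Cmod_opp; lra.
Qed.

(** A local identity theorem: the $f_n$ are uniformly small where $g$ vanishes and uniformly bounded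
    on the larger disc, hence small on the middle one. *)
Lemma zero_propagation y s d : 0 < d -> 0 < s -> (forall z, Cmod (z - y) <= 3 * s -> omega z < rho) ->
  (forall z, Cmod (z - y) <= d -> g z = 0%C) -> forall z, Cmod (z - y) <= 2 * s -> g z = 0%C.
Proof.
intros Hd Hs Hin H0 z Hz.
apply Cmod_eq_0, Rle_antisym; [|apply Cmod_ge_0].
apply le_epsilon; intros eta Heta; rewrite Rplus_0_l.
destruct (level_disc_bound y (3 * s) Hin) as [M [HM HMe]].
destruct (small_propagation (Rmin d (3 * s)) (2 * s) (3 * s) M (eta / 2)) as [eps [He Hprop]]; try lra.
{ apply Rmin_pos; lra. }
assert (Hu := level_uniform _ (Ccompact_annulus y 0 (3 * s)) (fun z Kz => Hin z (proj2 Kz)) (mkposreal eps He)).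
assert (Heta2 : 0 < eta / 2) by lra.
assert (Ht := tends_to_eventually _ _ (eta / 2) (hg z (Hin z ltac:(lra))) Heta2).
destruct (filter_and _ _ (filter_and _ _ HMe Hu) Ht) as [N HN].
destruct (HN N (le_n N)) as [[H1 H2] H3]; simpl in H2.
assert (H4 : Cmod (f N z) <= eta / 2).
{ apply (Hprop (f N) y); try assumption.
  - intros w _; eexists; apply entire_Cder.
  - intros w Hw. assert (W1 := Rle_trans _ _ _ Hw (Rmin_l _ _)). assert (W2 := Rle_trans _ _ _ Hw (Rmin_r _ _)).
    specialize (H2 w (conj (Cmod_ge_0 _) W2)). rewrite (H0 w W1) in H2.
    replace (f N w - 0)%C with (f N w) in H2 by ring. lra. }
replace (g z) with (- (f N z - g z) + f N z)%C by ring.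
eapply Rle_trans; [apply Cmod_triangle|]. rewrite Cmod_opp; lra.
Qed.

Lemma limit_nonzero_nearby U : nonconstant_on_open g (sublevel omega rho) -> Copen U ->
  (exists w, U w /\ omega w < rho) -> exists w, U w /\ omega w < rho /\ g w <> 0%C.
Proof.
intros Hnc HU [w [Uw Hw]]; apply NNPP; intros Hno.
assert (H0 : forall v, U v -> omega v < rho -> g v = 0%C).
{ intros v Uv Hv; apply NNPP; intros Hn; apply Hno; exists v; repeat split; assumption. }
(* The interior of the zero set of $g$ in $D_\rho$. It and its complement $V$ in $D_\rho$ are both
   open, so a connected set that meets $Z$ stays in it. *)
pose (Z := fun x => exists s, 0 < s /\ forall v, Cmod (v - x) < s -> omega v < rho /\ g v = 0%C).
assert (HZ : Copen Z).
{ apply Copen_spec; intros x [s [Hs Hx]]; exists (s / 2); split; [lra|]; intros y Hy.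
  exists (s / 2); split; [lra|]; intros v Hv; apply Hx.
  replace (v - x)%C with ((v - y) + (y - x))%C by ring.
  eapply Rle_lt_trans; [apply Cmod_triangle | lra]. }
pose (V := fun x => omega x < rho /\ ~ Z x).
assert (HV : Copen V).
{ apply Copen_spec; intros x [Hx Zx].
  destruct (proj1 (Copen_spec _) (Copen_sublevel omega rho homega) x Hx) as [t [Ht Ht']].
  (* For $|y-x|<s$, the disc of radius $2s$ about $y$ covers the disc of radius $s$ about $x$, and
     the one of radius $3s$ stays within $4s<t$ of $x$. *)
  pose (s := t / 5).
  assert (Hs : 0 < s) by (unfold s; lra).
  assert (Hin : forall v, Cmod (v - x) <= 4 * s -> omega v < rho) by (intros v Hv; apply Ht'; unfold s in Hv; lra).
  exists s; split; [exact Hs|]; intros y Hy; split; [apply Hin; lra|].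
  intros [d [Hd Hd']]; apply Zx; exists s; split; [exact Hs|]; intros v Hv; split; [apply Hin; lra|].
  apply (zero_propagation y s (d / 2)); try lra.
  - intros u Hu; apply Hin. replace (u - x)%C with ((u - y) + (y - x))%C by ring.
    eapply Rle_trans; [apply Cmod_triangle | lra].
  - intros u Hu; apply Hd'; lra.
  - replace (v - y)%C with ((v - x) + - (y - x))%C by ring.
    eapply Rle_trans; [apply Cmod_triangle|]. rewrite Cmod_opp; lra. }
assert (Zw : Z w).
{ destruct (proj1 (Copen_spec _) (Copen_and _ _ HU (Copen_sublevel omega rho homega)) w (conj Uw Hw)) as [s [Hs Hs']].
  exists s; split; [exact Hs|]; intros v Hv; destruct (Hs' v Hv); split; [assumption | apply H0; assumption]. }
assert (Hcomp : forall a, component (sublevel omega rho) w a -> g a = 0%C).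
{ intros a [A [HA [HAD [Aw Aa]]]].
  apply NNPP; intros Hga.
  destruct (HA Z V HZ HV) as [x [_ [Zx [_ NZ]]]].
  - intros x Ax; destruct (classic (Z x)) as [H|H]; [left; exact H | right; split; [apply HAD, Ax | exact H]].
  - exists w; split; assumption.
  - exists a; split; [exact Aa|]. split; [apply HAD, Aa|]. intros [s [Hs Hs']]; apply Hga, Hs'.
    unfold Cminus; rewrite Cplus_opp_r, Cmod_0; exact Hs.
  - exact (NZ Zx). }
destruct (Hnc w Hw) as [a [b [Ha [Hb Hab]]]].
apply Hab; rewrite (Hcomp a Ha), (Hcomp b Hb); reflexivity.
Qed.

Lemma zero_free_growth lambda w1 w2 e n0 : admissible_exponents f lambda -> 0 < e ->
  (forall n z, (n0 <= n)%nat -> square w1 (20 * e) z -> f n z <> 0%C) ->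
  omega w1 < rho -> g w1 <> 0%C -> Cmod (w2 - w1) <= 2 * e ->
  ~ Rbar_lt 1 (growth_function f lambda w2).
Proof.
intros Hadm He Hzf Hw1 Hg1 Hw2.
assert (Hlim := proj1 (proj2 Hadm)).
apply growth_le_1; [exact Hlim|]; intros eta Heta.
set (gam := Cmod (g w1)).
assert (Hgam : 0 < gam) by (apply Cmod_gt_0; exact Hg1).
assert (Hw11 : Cmod (w1 - w1) = 0) by (unfold Cminus; rewrite Cplus_opp_r; apply Cmod_0).
destruct (admissible_bound f lambda w1 (16 * e) hf Hadm) as [B [HB HBe]].
destruct (proj1 (Copen_spec _) (Copen_sublevel omega rho homega) w1 Hw1) as [t [Ht Ht']].
(* The small disc lies in $D_\rho$ and is strictly smaller than the one of radius $16e$. An eighth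
   of the latter is $2e$, which reaches $w_2$; the square of half-side $20e$ contains it. *)
pose (d := Rmin (t / 2) (8 * e)).
assert (Hd : 0 < d) by (unfold d; apply Rmin_pos; lra).
assert (Hd1 : d <= t / 2) by apply Rmin_l.
assert (Hd2 : d <= 8 * e) by apply Rmin_r.
destruct (level_disc_bound w1 d) as [M [HM HMe]].
{ intros z Hz; apply Ht'; lra. }
destruct (Re_small_propagation d (16 * e) (B + 1) (eta / 2)) as [eps [Heps Hprop]]; try lra.
assert (Hg2 : 0 < gam / 2) by lra.
assert (HN0 : eventually (fun n => (n0 <= n)%nat)) by (exists n0; auto).
(* The thresholds on $\lambda_n$, with $|f_n(w_1)|\ge\gamma/2$: the second gives
   $\mathrm{Re}\,G_n\le B+1$ on the large disc, the third $\mathrm{Re}\,G_n\le\varepsilon$ on the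
   small one, and the last $\ln|f_n(w_1)|\le\ln M<\lambda_n\eta/2$, so that undoing the
   normalisation costs only half of $\eta$. *)
generalize (filter_and _ _ (filter_and _ _ HBe HMe) (filter_and _ _ (filter_and _ _ HN0
  (tends_to_eventually _ _ (gam / 2) (hg w1 Hw1) Hg2))
  (filter_and _ _ (filter_and _ _ (eventually_ge lambda 0 Hlim) (eventually_ge lambda (- ln (gam / 2)) Hlim))
   (filter_and _ _ (eventually_ge lambda ((ln M - ln (gam / 2)) / eps) Hlim) (eventually_ge lambda (ln M / (eta / 2)) Hlim))))).
apply filter_imp; intros n [[HnB HnM] [[Hnn Hng] [[L0 L1] [L2 L3]]]].
apply Rlt_div_l in L2; [|lra]. apply Rlt_div_l in L3; [|lra].
assert (Hsq : forall z, Cmod (z - w1) <= 16 * e -> square w1 (20 * e) z).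
{ intros z Hz. destruct (Cmod_fst_snd (z - w1)%C) as [A1 A2].
  change (fst (z - w1)%C) with (fst z - fst w1) in A1; change (snd (z - w1)%C) with (snd z - snd w1) in A2.
  split; lra. }
assert (Hpos : forall z, Cmod (z - w1) <= 16 * e -> 0 < Cmod (f n z)).
{ intros z Hz; apply Cmod_gt_0, Hzf; [exact Hnn | apply Hsq, Hz]. }
assert (Hgn : gam / 2 <= Cmod (f n w1)).
{ assert (T := Cmod_rev_triangle (f n w1) (g w1)). fold gam in T.
  apply Rabs_le_between in T; lra. }
apply ln_le in Hgn; [|exact Hg2].
destruct (log_branch w1 (20 * e) (f n) (C_derive (f n))) as [Q [HQ [Qc HQre]]]; [lra|apply entire_Cder|intros z Hz; apply Hzf; assumption|].
assert (Hlw := Hpos w1 ltac:(lra)).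
assert (Hre : forall z, Cmod (z - w1) <= 16 * e -> Re (RtoC (/ lambda n) * Q z)%C = / lambda n * (ln (Cmod (f n z)) - ln (Cmod (f n w1)))).
{ intros z Hz; rewrite re_scal_l, HQre by (apply Hsq, Hz); reflexivity. }
assert (Hinv : forall x y, x <= lambda n * y -> / lambda n * x <= y).
{ intros x y Hxy; apply Rmult_le_reg_l with (lambda n); [exact L0|].
  rewrite <- Rmult_assoc, Rinv_r, Rmult_1_l by lra; exact Hxy. }
assert (HG := Hprop (fun z => RtoC (/ lambda n) * Q z)%C w1).
assert (Hfin : Cmod (RtoC (/ lambda n) * Q w2) <= eta / 2).
{ apply HG.
  - intros z Hz; destruct (HQ z (Hsq z Hz)) as [l Hl].
    eexists; apply Cder_mult; [apply Cder_const | exact Hl].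
  - rewrite Qc; ring.
  - intros z Hz; rewrite (Hre z Hz); apply Hinv.
    assert (X := HnB z Hz). apply ln_le in X; [|apply Hpos, Hz]. rewrite ln_exp in X. lra.
  - intros z Hz; rewrite (Hre z ltac:(lra)); apply Hinv.
    assert (X := HnM z Hz). apply ln_le in X; [|apply Hpos; lra]. lra.
  - lra. }
assert (Hw216 : Cmod (w2 - w1) <= 16 * e) by lra.
assert (X := re_le_Cmod (RtoC (/ lambda n) * Q w2)%C).
rewrite (Hre w2 Hw216) in X.
assert (X2 : / lambda n * (ln (Cmod (f n w2)) - ln (Cmod (f n w1))) <= eta / 2).
{ eapply Rle_trans; [apply Rle_abs|]. lra. }
apply Rmult_le_compat_l with (r := lambda n) in X2; [|lra].
rewrite <- Rmult_assoc, Rinv_r, Rmult_1_l in X2 by lra.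
assert (X3 := HnM w1 ltac:(lra)). apply ln_le in X3; [|exact Hlw].
rewrite <- (exp_ln (Cmod (f n w2))) by (apply Hpos, Hw216).
assert (X4 : ln (Cmod (f n w2)) < eta * lambda n) by lra.
apply Rlt_le, exp_increasing, X4.
Qed.
End Level.

Theorem theorem2
  (omega : C -> R) (homega : proper_height omega)
  (f : nat -> C -> C) (hf : forall n : nat, entire (f n))
  (rho : R) (hrho : 0 < rho)
  (hlevel : convergence_level omega f = Finite rho)
  (g : C -> C)
  (hg : forall z : C, sublevel omega rho z -> tends_to (fun n => f n z) (g z))
  (hnonconst : nonconstant_on_open g (sublevel omega rho))
  (lambda : nat -> R) (hlambda : admissible_exponents f lambda)
  (r : R) (hr : 0 < r)
  (hmu : forall z : C, rho < omega z ->
     Rbar_lt 1 (growth_function f lambda z) \/ omega z = r) :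
  (forall z : C, Cboundary (sublevel omega rho) z ->
     cluster_point_of_zeros f z) /\
  maximal_open_pointwise_convergence f (sublevel omega rho).
Proof.
assert (Hlim := proj1 (proj2 hlambda)).
split.
- intros z0 [Hcl1 Hcl2].
  assert (Hz0 : rho <= omega z0).
  { apply Rnot_lt_le; intros Hlt.
    destruct (Hcl2 _ (Copen_sublevel omega rho homega) Hlt) as [w [H1 H2]]; exact (H2 H1). }
  intros U HU Uz0 n0; apply NNPP; intros Hno.
  destruct (proj1 (Copen_spec _) HU z0 Uz0) as [s [Hs Hs']].
  (* The square of half-side $20e$ about $w_1$ lies within $20e+20e+e=41e<s$ of $z_0$. *)
  pose (e := s / 100).
  assert (He : 0 < e) by (unfold e; lra).
  (* Both $w_1$, the centre of the logarithms, and $w_2$, where $\mu>1$, are taken within $e$ of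
     $z_0$, hence within $2e$ of each other. *)
  destruct (limit_nonzero_nearby omega f rho g homega hf hlevel hg (fun w => Cmod (w - z0) < e) hnonconst (Copen_disc z0 e)) as [w1 [Hw1 [Hrw1 Hgw1]]].
  { apply (Hcl1 (fun w => Cmod (w - z0) < e)); [apply Copen_disc|].
    unfold Cminus; rewrite Cplus_opp_r, Cmod_0; exact He. }
  destruct (height_above_off_level omega rho r (fun w => Cmod (w - z0) < e) z0 homega hrho Hz0 (Copen_disc z0 e)) as [w2 [Hw2 [Hrw2 Hrr]]].
  { unfold Cminus; rewrite Cplus_opp_r, Cmod_0; exact He. }
  destruct (hmu w2 Hrw2) as [Hmu|E]; [|exact (Hrr E)].
  revert Hmu; apply (zero_free_growth omega f rho g homega hf hlevel hg lambda w1 w2 e n0); try assumption.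
  + intros n z Hn [Hz1 Hz2] E. apply Hno; exists n; split; [exact Hn|]; exists z; split; [|exact E].
    apply Hs'. replace (z - z0)%C with ((z - w1) + (w1 - z0))%C by ring.
    eapply Rle_lt_trans; [apply Cmod_triangle|].
    assert (X := Cmod_le_abs (fst z - fst w1) (snd z - snd w1)).
    change (fst z - fst w1, snd z - snd w1) with (z - w1)%C in X.
    unfold e in *; lra.
  + replace (w2 - w1)%C with ((w2 - z0) + - (w1 - z0))%C by ring.
    eapply Rle_trans; [apply Cmod_triangle|]. rewrite Cmod_opp; lra.
- split; [apply Copen_sublevel, homega|]. split.
  + intros z Hz; exists (g z); apply hg, Hz.
  + intros U HU Hconv z Uz. apply Rnot_le_lt; intros Hle.
    destruct (height_above_off_level omega rho r U z homega hrho Hle HU Uz) as [w [Uw [Hw Hwr]]].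
    destruct (hmu w Hw) as [Hmu|E]; [|exact (Hwr E)].
    destruct (Hconv w Uw) as [l Hl].
    exact (convergent_growth f lambda w l Hlim Hl Hmu).
Qed.
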